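(* Let $M^n$ be a closed topological $n$-manifold with a metric $d$, and let $f^t:M^n\to M^n$ be a topological flow whose chain recurrent set $\mathcal R_{f^t}$ is finite and hyperbolic (that is, $\mathcal R_{f^t}$ is a finite set, hence consists of fixed points of $f^t$, and every one of these fixed points is topologically hyperbolic). Then $f^t$ admits a Morse energy function; that is, there exists a continuous Morse function $\varphi:M^n\to\mathbb R$ such that (1) $\varphi(f^t(x))<\varphi(x)$ for every $x\in M^n\setminus\mathcal R_{f^t}$ and every $t>0$; (2) the set $Cr_\varphi$ of critical points of $\varphi$ coincides with $\mathcal R_{f^t}$, and $\nu_p=\lambda_p$ for every fixed point $p$ of $f^t$, where $\nu_p$ is the index of $p$ as a non-degenerate critical point of $\varphi$ and $\lambda_p$ is the index of $p$ as a topologically hyperbolic fixed point of $f^t$.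
   Context: Manifolds are topological manifolds; no smooth structure is assumed. Topological flow: a family of homeomorphisms $f^t:M^n\to M^n$, $t\in\mathbb R$, depending continuously on $t$, with $f^0(x)=x$ and $f^t(f^s(x))=f^{t+s}(x)$ for all $s,t\in\mathbb R$, $x\in M^n$. A fixed point is a point $x$ with $f^t(x)=x$ for all $t\in\mathbb R$. Chain recurrent set: an $\varepsilon$-chain of length $T$ connecting $x$ to $y$ is a sequence of points $x=x_0,\dots,x_m=y$ for which there is a sequence $t_1,\dots,t_m$ with $t_i\ge 1$ and $d(f^{t_i}(x_{i-1}),x_i)<\varepsilon$ for $1\le i\le m$, and $t_1+\dots+t_m=T$. A point $x$ is chain recurrent if for every $\varepsilon>0$ there are a $T$ and an $\varepsilon$-chain of length $T$ connecting $x$ to itself. $\mathcal R_{f^t}$ denotes the set of all chain recurrent points. Linear model: for $\lambda\in\{0,1,\dots,n\}$, the flow $a^t_\lambda:\mathbb R^n\to\mathbb R^n$ is $$a^t_\lambda(x_1,\dots,x_\lambda,x_{\lambda+1},\dots,x_n)=(2^tx_1,\dots,2^tx_\lambda,2^{-t}x_{\lambda+1},\dots,2^{-t}x_n).$$ A fixed point $p$ of $f^t$ is topologically hyperbolic if there are a neighborhood $U_p\subset M^n$ of $p$, a number $\lambda_p\in\{0,1,\dots,n\}$ and a homeomorphism $h_p:U_p\to\mathbb R^n$ such that $h_pf^t|_{U_p}=a^t_{\lambda_p}h_p|_{U_p}$ whenever both sides are defined. The homeomorphism $h_p$ carries $p$ to the origin. The number $\lambda_p$ is called the index of $p$. Continuous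 Morse function: let $\varphi:M^n\to\mathbb R$ be continuous. A point $p\in M^n$ is regular for $\varphi$ if there are a neighborhood $V_p$ of $p$ and a homeomorphism $\phi_p:y\mapsto(x_1(y),\dots,x_n(y))$ from $V_p$ onto an open subset of $\mathbb R^n$ with $x_i(p)=0$ for all $i$ and $\varphi(y)=\varphi(p)+x_n(y)$ for $y\in V_p$. Otherwise $p$ is critical. $Cr_\varphi$ denotes the set of critical points. A critical point $p$ is non-degenerate of index $\nu_p\in\{0,\dots,n\}$ if there are such local coordinates $(x_1,\dots,x_n)$ on a neighborhood $V_p$ of $p$, with $x_i(p)=0$ for all $i$, such that $\varphi(y)=\varphi(p)-\sum_{i=1}^{\nu_p}x_i^2(y)+\sum_{i=\nu_p+1}^nx_i^2(y)$ for $y\in V_p$. A continuous Morse function is a continuous function all of whose critical points are non-degenerate. *)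

(* Defs.v *)
From HB Require Import structures.
From mathcomp Require Import all_boot all_order all_algebra.
From mathcomp Require Import all_classical all_reals all_analysis.

Set Implicit Arguments.
Unset Strict Implicit.
Unset Printing Implicit Defensive.

Import Order.TTheory GRing.Theory Num.Theory.
Import numFieldNormedType.Exports.

Local Open Scope classical_set_scope.
Local Open Scope ring_scope.

(* [h] restricts to a homeomorphism from the subspace [A] onto the subspace
   [B]; the values of [h] outside [A] are irrelevant. *)
Definition homeomorphism_on (X Y : topologicalType) (A : set X) (B : set Y)
    (h : X -> Y) : Prop :=
  exists g : Y -> X,
    [/\ set_fun A B h /\ set_fun B A g,
        {in A, cancel h g} /\ {in B, cancel g h},
        {within A, continuous h}
      & {within B, continuous g}].

(* The topology of [M] is that of its distance [mdist], so being Hausdorff is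
   automatic and second countability follows from compactness.  Connectedness
   is not required. *)
Definition closed_manifold (R : realType) (n : nat) (M : metricType R) : Prop :=
  compact [set: M] /\
  forall p : M, exists (V : set M) (W : set 'rV[R]_n) (h : M -> 'rV[R]_n),
    [/\ nbhs p V, open W & homeomorphism_on V W h].

(* Continuous dependence on time is joint continuity in time and position.
   Each [f t] is then a homeomorphism, with inverse [f (- t)]. *)
Definition topological_flow (R : realType) (M : metricType R)
    (f : R -> M -> M) : Prop :=
  [/\ continuous (fun tx : R * M => f tx.1 tx.2),
      forall x, f 0 x = x
    & forall t s x, f t (f s x) = f (t + s) x].

Definition fixed_point (R : realType) (M : metricType R) (f : R -> M -> M)
    (p : M) : Prop :=
  forall t, f t p = p.

(* The condition [0 < m] matters: a chain without any step would make every
   point chain recurrent.  The value [ts 0] is not used. *)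
Definition epsilon_chain (R : realType) (M : metricType R) (f : R -> M -> M)
    (eps T : R) (x y : M) : Prop :=
  exists (m : nat) (xs : nat -> M) (ts : nat -> R),
    [/\ (0 < m)%N, xs 0%N = x, xs m = y,
        (forall i, (1 <= i <= m)%N ->
           1 <= ts i /\ mdist (f (ts i) (xs i.-1)) (xs i) < eps)
      & \sum_(1 <= i < m.+1) ts i = T].

Definition chain_recurrent_set (R : realType) (M : metricType R)
    (f : R -> M -> M) : set M :=
  [set x | forall eps : R, 0 < eps -> exists T : R, epsilon_chain f eps T x x].

Definition linear_flow (R : realType) (n lam : nat) (t : R) (x : 'rV[R]_n) :
    'rV[R]_n :=
  \row_(i < n) (if (i < lam)%N then 2 `^ t * x 0 i else 2 `^ (- t) * x 0 i).

Definition hyperbolic_of_index (R : realType) (n : nat) (M : metricType R)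
    (f : R -> M -> M) (p : M) (lam : nat) : Prop :=
  [/\ fixed_point f p, (lam <= n)%N &
    exists (U : set M) (h : M -> 'rV[R]_n),
      [/\ nbhs p U, homeomorphism_on U [set: 'rV[R]_n] h, h p = 0 &
        forall t x, U x -> U (f t x) -> h (f t x) = linear_flow lam t (h x)]].

Definition topologically_hyperbolic (R : realType) (n : nat)
    (M : metricType R) (f : R -> M -> M) (p : M) : Prop :=
  exists lam : nat, hyperbolic_of_index n f p lam.

Definition local_coordinates (R : realType) (n : nat) (M : metricType R)
    (p : M) (V : set M) (h : M -> 'rV[R]_n) : Prop :=
  [/\ nbhs p V, h p = 0 &
    exists W : set 'rV[R]_n, open W /\ homeomorphism_on V W h].

(* The index [i] with [i.+1 = n] is the last coordinate; for [n = 0] there is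
   none, and no point is regular. *)
Definition regular_point (R : realType) (n : nat) (M : metricType R)
    (phi : M -> R) (p : M) : Prop :=
  exists (V : set M) (h : M -> 'rV[R]_n) (i : 'I_n),
    [/\ local_coordinates p V h, i.+1 = n :> nat &
      forall y, V y -> phi y = phi p + h y 0 i].

Definition critical_set (R : realType) (n : nat) (M : metricType R)
    (phi : M -> R) : set M :=
  [set p | ~ regular_point n phi p].

Definition nondegenerate_of_index (R : realType) (n : nat) (M : metricType R)
    (phi : M -> R) (p : M) (nu : nat) : Prop :=
  [/\ critical_set n phi p, (nu <= n)%N &
    exists (V : set M) (h : M -> 'rV[R]_n),
      local_coordinates p V h /\
      forall y, V y ->
        phi y = phi p - \sum_(i < n | (i < nu)%N) h y 0 i ^+ 2
                      + \sum_(i < n | (nu <= i)%N) h y 0 i ^+ 2].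

Definition continuous_morse_function (R : realType) (n : nat)
    (M : metricType R) (phi : M -> R) : Prop :=
  continuous phi /\
  forall p, critical_set n phi p -> exists nu, nondegenerate_of_index n phi p nu.

(* Indices are relations, not functions: that they are well defined is a
   topological fact.  The last clause says that every index of [p] for [phi]
   equals every index of [p] for [f]; both exist by the other clauses when the
   chain recurrent points are topologically hyperbolic. *)
Definition morse_energy_function (R : realType) (n : nat) (M : metricType R)
    (f : R -> M -> M) (phi : M -> R) : Prop :=
  [/\ continuous_morse_function n phi,
      (forall x, ~ chain_recurrent_set f x ->
         forall t, 0 < t -> phi (f t x) < phi x),
      critical_set n phi = chain_recurrent_set f
    & forall p, fixed_point f p -> forall lam nu,
        hyperbolic_of_index n f p lam -> nondegenerate_of_index n phi p nu ->
        nu = lam].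

(* Main.v *)
(* Every continuous function that strictly decreases along the flow outside the
   chain recurrent set is already a Morse energy function, so a complete Lyapunov
   function suffices.
   Around a hyperbolic fixed point [p] of index [lam], both the function and the
   standard quadratic form of index [lam] decrease along the linear flow; sliding
   each point along its orbit until the values of the two functions agree is a
   homeomorphism, also across the stable and unstable spaces, and brings the
   function to normal form. A point outside the chain recurrent set flows
   backwards into such a neighbourhood, where the same sliding compares the
   function with a coordinate; a general flow box would not do, since its
   transversal need not be Euclidean.
   That the quadratic forms of different indices and a linear form have
   pairwise distinct topological germs follows from Brouwer's theorem and from
   the fact that a map into a space of larger dimension can be moved off the
   origin. The Lyapunov function is a weighted sum, over rational times, of
   functions attached to the attractor blocks of points reachable by
   [e]-chains. *)

(* Nothing is known about the rate at which a continuous Lyapunov function decreases, so the factor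
   by which a point slides may be unbounded near the fixed point, and no continuous sliding time is
   available there. Sliding is therefore treated as a relation. An infinite factor could only link a
   stable point to an unstable one; these are kept apart by the value at the fixed point, which lies
   strictly between the values on the two punctured spaces. The norm on row vectors is the maximum
   norm. Balls are thus cubes, which can be cut into grids, and they meet each orbit of the linear
   flow in an arc. The comparison of germs is used twice: against a linear form it shows that chain
   recurrent points are critical, and between two quadratic forms it gives the equality of indices,
   which are only relations here. *)
Require Import Defs.
From mathcomp Require Import all_boot all_order all_algebra all_fingroup.
From mathcomp Require Import all_classical all_reals all_analysis.
From mathcomp Require Import zify ring lra.

Set Implicit Arguments.
Unset Strict Implicit.
Unset Printing Implicit Defensive.

Import Order.TTheory GRing.Theory Num.Theory.
Import numFieldNormedType.Exports.

Local Open Scope classical_set_scope.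
Local Open Scope ring_scope.

(** * Continuity at a point *)

Section ContinuityAt.
Variables (R : realType) (T : topologicalType) (x : T).
Implicit Types f g : T -> R.

Lemma cont_cst (U : topologicalType) (c : U) : continuous_at x (fun=> c : U).
Proof. exact: cvg_cst. Qed.

Lemma cont_id : continuous_at x (fun t : T => t).
Proof. exact: cvg_id. Qed.

Lemma contD f g : continuous_at x f -> continuous_at x g ->
  continuous_at x (fun t => f t + g t).
Proof. by move=> cf cg; apply: cvgD. Qed.

Lemma contN f : continuous_at x f -> continuous_at x (fun t => - f t).
Proof. by move=> cf; apply: cvgN. Qed.

Lemma contB f g : continuous_at x f -> continuous_at x g ->
  continuous_at x (fun t => f t - g t).
Proof. by move=> cf cg; apply: cvgB. Qed.

Lemma contM f g : continuous_at x f -> continuous_at x g ->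
  continuous_at x (fun t => f t * g t).
Proof. by move=> cf cg; apply: cvgM. Qed.

Lemma contV f : f x != 0 -> continuous_at x f ->
  continuous_at x (fun t => (f t)^-1).
Proof. by move=> f0 cf; apply: cvgV. Qed.

Lemma cont_max f g : continuous_at x f -> continuous_at x g ->
  continuous_at x (fun t => Num.max (f t) (g t)).
Proof. by move=> cf cg; apply: continuous_max. Qed.

Lemma cont_min f g : continuous_at x f -> continuous_at x g ->
  continuous_at x (fun t => Num.min (f t) (g t)).
Proof. by move=> cf cg; apply: continuous_min. Qed.

Lemma cont_sum (I : Type) (r : seq I) (P : pred I) (F : I -> T -> R) :
  (forall i, P i -> continuous_at x (F i)) ->
  continuous_at x (fun t => \sum_(i <- r | P i) F i t).
Proof.
move=> cF; elim: r => [|i r IH].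
  by under eq_fun do rewrite big_nil; exact: cont_cst.
under eq_fun do rewrite big_cons.
by case Pi: (P i) => //; apply: contD => //; exact: cF.
Qed.

Lemma cont_norm (V : normedModType R) (f : T -> V) : continuous_at x f ->
  continuous_at x (fun t => `|f t|).
Proof. by move=> cf; apply: (@cvg_norm _ V _ _ _ f). Qed.

Lemma cont_comp (U W : topologicalType) (f : T -> U) (g : U -> W) :
  continuous_at x f -> continuous_at (f x) g ->
  continuous_at x (fun t => g (f t)).
Proof. by move=> cf cg; apply: continuous_comp. Qed.

Lemma cont_pair (U W : topologicalType) (f : T -> U) (g : T -> W) :
  continuous_at x f -> continuous_at x g ->
  continuous_at x (fun t => (f t, g t)).
Proof. by move=> cf cg; apply: cvg_pair. Qed.

Lemma cont_coord m (f : T -> 'rV[R]_m) j : continuous_at x f ->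
  continuous_at x (fun t => f t 0 j).
Proof.
move=> cf; apply: (cont_comp (g := fun v : 'rV[R]_m => v 0 j) cf).
exact: coord_continuous.
Qed.

Lemma cont_row m (f : T -> 'rV[R]_m) :
  (forall j, continuous_at x (fun t => f t 0 j)) -> continuous_at x f.
Proof.
move=> cf A [P PA sPA]; have : \forall t \near x, forall j, P 0 j (f t 0 j).
  by apply: filter_forall => j; exact: (cf j).
apply: filterS => t tP; apply: sPA => i j.
by rewrite ord1; exact: tP.
Qed.

End ContinuityAt.

Lemma cont_sub (R : realType) (T : topologicalType) (V : normedModType R) (f g : T -> V) (x : T) :
  continuous_at x f -> continuous_at x g ->
  continuous_at x (fun t => f t - g t).
Proof. by move=> cf cg; apply: cvgB. Qed.

Lemma cont_add (R : realType) (T : topologicalType) (V : normedModType R) (f g : T -> V) (x : T) :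
  continuous_at x f -> continuous_at x g ->
  continuous_at x (fun t => f t + g t).
Proof. by move=> cf cg; apply: cvgD. Qed.

Lemma cont_scale (R : realType) (T : topologicalType) (V : normedModType R)
    (f : T -> R) (g : T -> V) (x : T) :
  continuous_at x f -> continuous_at x g ->
  continuous_at x (fun t => f t *: g t).
Proof. by move=> cf cg; apply: cvgZ. Qed.

Lemma cont_lipschitz (R : realType) (V : normedModType R) (g : V -> R) (L : R) (y : V) :
  0 <= L -> (forall y z, `|g y - g z| <= L * `|y - z|) -> continuous_at y g.
Proof.
move=> L0 h; apply/cvgrPdist_lt => t t0.
have d0 : 0 < t / (L + 1) by rewrite divr_gt0 // ltr_wpDl.
have := nbhsx_ballx y _ d0; apply: filterS => z; rewrite -ball_normE /= => yz.
apply: (le_lt_trans (h _ _)); apply: (@le_lt_trans _ _ ((L + 1) * `|y - z|)).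
  by rewrite ler_wpM2r // lerDl.
by rewrite mulrC -ltr_pdivlMr // ltr_wpDl.
Qed.

Lemma compact_closed_cball (R : realType) m r :
  compact [set y : 'rV[R]_m | `|y| <= r].
Proof.
apply: bounded_closed_compact.
  exists r; split; rewrite ?num_real // => M rM y /= yr.
  by rewrite (le_trans yr) ?ltW.
apply: (@closed_comp _ _ (fun y : 'rV[R]_m => `|y|) [set t | t <= r]); last exact: closed_le.
move=> y _; exact: norm_continuous.
Qed.

Arguments contD R {T x f g}.
Arguments contN R {T x f}.
Arguments contB R {T x f g}.
Arguments contM R {T x f g}.
Arguments contV R {T x f}.
Arguments cont_max R {T x f g}.
Arguments cont_min R {T x f g}.
Arguments cont_sum R {T x I r P F}.

(** * A cubical Sperner lemma *)

Section CubicalSperner.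
Variables (n p : nat) (K : comNzRingType).
Hypothesis K2 : forall x : K, x + x = 0.
Implicit Types (x y : 'I_n -> nat) (a b i : 'I_n) (A : {set 'I_n}).
Implicit Types (l : seq 'I_n) (g h : ('I_n -> nat) -> K).
Variable s : 'I_n -> ('I_n -> nat) -> K.

Definition step a x : 'I_n -> nat := fun j => (x j + (j == a))%N.
Definition upd a (k : nat) x : 'I_n -> nat := fun j => if j == a then k else x j.

(* The cup product of the coboundaries of the labels [s i], [i] in [l], summed
   over the simplices of the cube with lowest vertex [x] and directions [A];
   no signs are needed in characteristic 2. *)
Fixpoint cup l A x : K :=
  if l is i :: l' then
    \sum_(a in A) (s i x + s i (step a x)) * cup l' (A :\ a) (step a x)
  else 1.

Fixpoint gridsum l g x : K :=
  if l is a :: l' then \sum_(k < p) gridsum l' g (upd a k x) else g x.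

Lemma stepC a b x : step a (step b x) = step b (step a x).
Proof. by apply/funext => j; rewrite /step addnAC. Qed.

Lemma upd_step a k x : step a (upd a k x) = upd a k.+1 x.
Proof.
by apply/funext => j; rewrite /step /upd; case: eqP; rewrite ?addn0 ?addn1.
Qed.

Lemma updC a b k m x : a != b -> upd a k (upd b m x) = upd b m (upd a k x).
Proof.
move=> ab; apply/funext => j; rewrite /upd.
by case: (eqVneq j a) => // ->; rewrite (negbTE ab).
Qed.

(** This is the cocycle property of a product of coboundaries. Expanding the first factor leaves,
    besides the induction hypothesis, only terms indexed by ordered pairs of directions, which
    cancel or match after exchanging the directions. *)
Lemma cup_closed l A x :
  \sum_(a in A) (cup l (A :\ a) x + cup l (A :\ a) (step a x)) = 0.
Proof.
elim: l A x => [|i l IH] A x /=; first by rewrite big1 // => a _; rewrite K2.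
pose D b y := s i y + s i (step b y).
transitivity (\sum_(b in A) D b x * \sum_(a in A :\ b)
   (cup l (A :\ b :\ a) (step b x) + cup l (A :\ b :\ a) (step a (step b x)))).
  under [in RHS]eq_bigr do rewrite mulr_sumr.
  under [in RHS]eq_bigr do under eq_bigr do rewrite mulrDr.
  under [in RHS]eq_bigr do rewrite big_split.
  rewrite !big_split /=; congr (_ + _).
    rewrite (exchange_big_dep (mem A)) /=; last by move=> a b _; case/setD1P.
    apply: eq_bigr => b bA; apply: eq_big => [a|a _].
      by rewrite !inE bA andbT andbC (eq_sym b).
    by congr (_ * cup _ _ _); rewrite finset.setDDl finset.setUC -finset.setDDl.
  pose F a b := cup l (A :\ a :\ b) (step a (step b x)).
  have FC a b : F a b = F b a.
    by rewrite /F stepC finset.setDDl finset.setUC -finset.setDDl.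
  rewrite [LHS](_ : _ =
            \sum_(a in A) \sum_(b in A :\ a) (s i (step a x) * F a b)
          + \sum_(a in A) \sum_(b in A :\ a) (s i (step b (step a x)) * F a b)); last first.
    rewrite -big_split; apply: eq_bigr => a _; rewrite -big_split.
    by apply: eq_bigr => b _; rewrite /= -mulrDl /F [step a (step b x)]stepC.
  (* In characteristic 2 the two orders of a pair of directions cancel. *)
  have sym0 (E : 'I_n -> 'I_n -> K) : (forall a b, E a b = E b a) ->
      \sum_(a in A) \sum_(b in A :\ a) E a b = 0.
    move=> EC.
    rewrite (eq_bigr (fun a => \sum_(b in A | (b < a)%N) E a b
                             + \sum_(b in A | (a < b)%N) E a b)); last first.
      move=> a aA; rewrite (bigID (fun b => (b < a)%N)) /=.
      by congr (_ + _); apply: eq_bigl => b; rewrite !inE -val_eqE /=;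
        case: ltngtP; rewrite ?andbT ?andbF.
    rewrite big_split /= [X in _ + X](exchange_big_dep (mem A)) /=; last by move=> a b _ /andP[].
    rewrite -big_split big1 // => a aA /=.
    rewrite [X in _ + X](eq_bigr (E a)); last by move=> b _; rewrite EC.
    rewrite [X in _ + X](eq_bigl (fun b => (b \in A) && (b < a)%N)) ?K2 //.
    by move=> b; rewrite aA.
  rewrite [X in _ + X]sym0 ?addr0; last first.
    by move=> a b; rewrite FC stepC.
  rewrite [RHS](_ : _ =
     \sum_(b in A) \sum_(a in A :\ b) s i x * F b a
   + \sum_(b in A) \sum_(a in A :\ b) s i (step b x) * F b a); last first.
    rewrite -big_split; apply: eq_bigr => a _; rewrite -big_split.
    by apply: eq_bigr => b _; rewrite /= -mulrDl /F [step a (step b x)]stepC.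
  by rewrite [X in X + _]sym0 ?add0r // => a b; rewrite FC.
by rewrite big1 // => b _; rewrite IH mulr0.
Qed.

(** Product rule: the cup product over [l] is closed, so multiplying by the coboundary of [s i] is
    the same as taking the coboundary of the product with [s i]. *)
Lemma cup_stokes i l A x :
  cup (i :: l) A x = \sum_(a in A) (s i x * cup l (A :\ a) x
                       + s i (step a x) * cup l (A :\ a) (step a x)).
Proof.
have := cup_closed l A x => /(congr1 (fun u => s i x * u)).
rewrite mulr0 mulr_sumr => E; rewrite -[LHS]addr0 -[X in _ + X]E /=.
rewrite -big_split /=; apply: eq_bigr => a _; apply/eqP; rewrite -subr_eq0.
by rewrite -(K2 (s i x * cup l (A :\ a) (step a x))); apply/eqP; ring.
Qed.

Lemma gridsumD l g h x :
  gridsum l (fun y => g y + h y) x = gridsum l g x + gridsum l h x.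
Proof.
elim: l x => //= a l IH x.
by rewrite -big_split; apply: eq_bigr => k _; rewrite IH.
Qed.

Lemma gridsum_sum A (g : 'I_n -> ('I_n -> nat) -> K) l x :
  gridsum l (fun y => \sum_(a in A) g a y) x = \sum_(a in A) gridsum l (g a) x.
Proof.
elim: l x => //= a l IH x.
by rewrite exchange_big; apply: eq_bigr => k _; rewrite IH.
Qed.

Lemma gridsum_rem a l g x : uniq l -> a \in l ->
  gridsum l g x = gridsum (a :: rem a l) g x.
Proof.
elim: l x => // b l IH x /= /andP[bl ul]; rewrite inE.
case: (eqVneq a b) => [->|ab] /= al //.

under eq_bigr do rewrite (IH _ ul al) /=.
rewrite exchange_big /=; apply: eq_bigr => k _; apply: eq_bigr => m _.
by rewrite updC.
Qed.

Lemma gridsum_eq (P : ('I_n -> nat) -> Prop) l g h x :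
  P x -> (forall y a k, a \in l -> P y -> P (upd a k y)) ->
  (forall y, P y -> g y = h y) -> gridsum l g x = gridsum l h x.
Proof.
elim: l x => [|a l IH] x Px Pupd gh /=; first exact: gh.
apply: eq_bigr => k _; apply: IH => //; first by apply: Pupd; rewrite ?mem_head.
by move=> y b m bl; apply: Pupd; rewrite inE bl orbT.
Qed.

Lemma gridsum0 l x : gridsum l (fun=> 0) x = 0.
Proof. by elim: l x => //= a l IH x; rewrite big1. Qed.

Lemma gridsum_tele a l g x : a \notin l ->
  gridsum (a :: l) (fun y => g y + g (step a y)) x
  = gridsum l g (upd a 0 x) + gridsum l g (upd a p x).
Proof.
move=> al /=.
have E k : gridsum l (fun y => g y + g (step a y)) (upd a k x) =
   gridsum l g (upd a k x) + gridsum l g (upd a k.+1 x).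
  rewrite gridsumD; congr (_ + _); elim: l al x => [|b l IH] al x /=.
    by rewrite upd_step.
  move: al; rewrite inE negb_or => /andP[ab al].
  apply: eq_bigr => m _.
  by rewrite -![upd b m (upd a _ x)]updC // IH.
under eq_bigr do rewrite E.
elim: p => [|q IH]; first by rewrite big_ord0 K2.
by rewrite big_ord_recr /= IH addrA -(addrA (gridsum l g _)) K2 addr0.
Qed.

Hypothesis s_lo : forall i x, x i = 0%N -> s i x = 0.
Hypothesis s_hi : forall i x, x i = p -> s i x = 1.

(** On a face where coordinate [a] is frozen at an end value, the label [s a] is constant, so its
    coboundary is a zero factor. *)
Lemma cup_face a l A x : a \in l -> a \notin A -> x a = 0%N \/ x a = p ->
  cup l A x = 0.
Proof.
elim: l A x => // i l IH A x; rewrite inE => al aA xa /=.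
apply: big1 => b bA.
have ab : a == b = false by apply/negbTE; apply: contraNneq aA => ->.
have stepa : step b x a = x a by rewrite /step ab addn0.
case: (eqVneq a i) al => [<- _|ai /= al].
  by case: xa => xa; [rewrite !s_lo ?stepa | rewrite !s_hi ?stepa] => //;
    rewrite K2 mul0r.
rewrite IH ?mulr0 ?stepa //.
by rewrite !inE ab.
Qed.

(** By [cup_stokes] only boundary faces contribute. Faces in directions of [l] vanish by [cup_face],
    the low face in direction [i] vanishes because [s i] is 0 there, and the high face, where [s i]
    is 1, is the same sum in one dimension less. *)
Lemma gridsum_cup l x : uniq l -> gridsum l (cup l [set i in l]) x = 1.
Proof.
elim: l x => // i l IH x uil; have /andP[il ul] := uil.
set A := [set j in i :: l].
pose c a y := s i y * cup l (A :\ a) y.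
have -> : cup (i :: l) A = fun y => \sum_(a in A) (c a y + c a (step a y)).
  by apply/funext => y; rewrite cup_stokes.
have updP a k m b y : b \in rem a (i :: l) -> y a = m -> upd b k y a = m.
  by rewrite mem_rem_uniq // !inE /upd eq_sym => /andP[/negbTE ->].
have E a : a \in A -> gridsum (i :: l) (fun y => c a y + c a (step a y)) x =
   gridsum (rem a (i :: l)) (c a) (upd a 0 x) +
   gridsum (rem a (i :: l)) (c a) (upd a p x).
  rewrite inE => al; rewrite (gridsum_rem _ _ uil al) gridsum_tele //.
  by rewrite mem_rem_uniq // inE eqxx.
rewrite gridsum_sum (eq_bigr _ E) (bigD1 i) ?inE ?eqxx // big1.
  rewrite (gridsum_eq (P := fun y => y i = 0%N) (h := fun=> 0)); first last.
  - by move=> y yi; rewrite /c s_lo ?mul0r.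
  - by move=> y a k al; apply: updP.
  - by rewrite /upd eqxx.
  rewrite gridsum0 (gridsum_eq (P := fun y => y i = p) (h := cup l [set j in l])); first last.
  - move=> y yi; rewrite /c s_hi // mul1r; congr cup.
    by apply/setP => j; rewrite !inE; case: eqP => // ->; rewrite (negbTE il).
  - by move=> y a k al; apply: updP.
  - by rewrite /upd eqxx.
  by rewrite /= eqxx IH // add0r addr0.
move=> a /andP[aA ai].
have al : a \in l by move: aA; rewrite !inE (negbTE ai).
have face m : m = 0%N \/ m = p -> gridsum (rem a (i :: l)) (c a) (upd a m x) = 0.
  move=> mP; rewrite -(gridsum0 (rem a (i :: l)) (upd a m x)).
  apply: (gridsum_eq (P := fun y => y a = m)).
  - by rewrite /upd eqxx.
  - by move=> y b k bl; apply: updP.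
  - by move=> y ya; rewrite /c (@cup_face a) ?mulr0 ?ya // !inE eqxx.
by rewrite (face 0%N) ?(face p) ?addr0; auto.
Qed.

Lemma gridsum_neq0 l g x : gridsum l g x != 0 ->
  exists2 y, g y != 0 & forall j, if j \in l then (y j < p)%N else y j == x j.
Proof.
elim: l x => [|a l IH] x /=; first by move=> gx; exists x.
move=> S0; have [k Sk] : exists k : 'I_p, gridsum l g (upd a k x) != 0.
  apply: contrapT => /forallNP N; move: S0; rewrite big1 ?eqxx // => k _.
  by have /negP := N k; rewrite negbK => /eqP.
have [y gy yP] := IH _ Sk; exists y => // j; have := yP j.
rewrite inE /upd; case: (j \in l); rewrite ?orbT // orbF.
by case: (eqVneq j a) => // _ /eqP ->.
Qed.

Lemma cup_neq0 l A x : cup l A x != 0 -> forall i, i \in l -> exists y z,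
  [/\ s i y != s i z, forall j, (x j <= y j <= x j + (j \in A))%N
    & forall j, (x j <= z j <= x j + (j \in A))%N].
Proof.
elim: l A x => // i l IH A x /= S0.
have [a /andP[aA Ta]] : exists a, (a \in A) &&
    ((s i x + s i (step a x)) * cup l (A :\ a) (step a x) != 0).
  apply: contrapT => /forallNP N; move: S0; rewrite big1 ?eqxx // => k kA.
  by have /negP := N k; rewrite kA negbK => /eqP.
have stepP j : (x j <= step a x j <= x j + (j \in A))%N.
  by rewrite /step leq_addr leq_add2l; case: eqP => // ->; rewrite aA.
move=> j; rewrite inE; case: (eqVneq j i) => [-> _|_ /= jl].
  exists x, (step a x); split=> // [|k]; last by rewrite leqnn leq_addr.
  by apply: contraNneq Ta => ->; rewrite K2 mul0r.
have T1 : cup l (A :\ a) (step a x) != 0 by apply: contraNneq Ta => ->; rewrite mulr0.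
have [y [z [yz yP zP]]] := IH _ _ T1 _ jl.
have bd w : (forall k, (step a x k <= w k <= step a x k + (k \in A :\ a))%N) ->
   forall k, (x k <= w k <= x k + (k \in A))%N.
  move=> wP k; have := wP k; rewrite /step !inE; case: eqP => [->|_] /=.
    by rewrite aA; lia.
  by rewrite addn0.
by exists y, z; split => //; apply: bd.
Qed.

End CubicalSperner.

(* By Stokes and induction on the dimension the total cup product is [1], so it
   is nonzero on some simplex, and there every label takes both values. *)
Lemma kuhn (n p : nat) (s : 'I_n -> ('I_n -> nat) -> bool) :
  (forall i x, x i = 0%N -> ~~ s i x) -> (forall i x, x i = p -> s i x) ->
  exists q : 'I_n -> nat, (forall j, (q j < p)%N) /\
    forall i, exists y z, [/\ s i y, ~~ s i z, forall j, (q j <= y j <= (q j).+1)%N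
      & forall j, (q j <= z j <= (q j).+1)%N].
Proof.
move=> slo shi; pose s' i x : 'F_2 := (s i x)%:R.
have K2 (x : 'F_2) : x + x = 0 by apply/val_inj; case: x => [[|[|]]].
have lo i x : x i = 0%N -> s' i x = 0 by rewrite /s' => /slo/negbTE->.
have hi i x : x i = p -> s' i x = 1 by rewrite /s' => /shi->.
have := gridsum_cup K2 lo hi (fun=> 0%N) (enum_uniq 'I_n).
move=> E; have : gridsum p (enum 'I_n) (cup s' (enum 'I_n) [set i in enum 'I_n]) (fun=> 0%N) != 0.
  by rewrite E oner_eq0.
case/gridsum_neq0 => q Tq qP; exists q; split=> [j|i].
  by have := qP j; rewrite mem_enum.
have [y [z [yz yP zP]]] := cup_neq0 K2 Tq (mem_enum 'I_n i).
have in1 j : (j \in [set i in enum 'I_n]) = true by rewrite inE mem_enum.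
have bd w : (forall k, (q k <= w k <= q k + (k \in [set i in enum 'I_n]))%N) ->
   forall k, (q k <= w k <= (q k).+1)%N.
  by move=> wP k; have := wP k; rewrite in1 addn1.
move: yz; rewrite /s'; case sy: (s i y); case sz: (s i z); rewrite ?eqxx // => _.
- by exists y, z; split; rewrite ?sy ?sz //; apply: bd.
- by exists z, y; split; rewrite ?sy ?sz //; apply: bd.
Qed.

(** * Brouwer's theorem *)

Lemma rV_norm_le (R : realType) m (x : 'rV[R]_m) e :
  0 <= e -> (forall i, `|x 0 i| <= e) -> `|x| <= e.
Proof.
move=> e0 xe; rewrite [leLHS]/Num.norm /= mx_normrE; apply/bigmax_leP; split=> //.
by move=> [i j] _; rewrite ord1.
Qed.

Lemma rV_norm_lt (R : realType) m (x : 'rV[R]_m) e :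
  0 < e -> (forall i, `|x 0 i| < e) -> `|x| < e.
Proof.
move=> e0 xe; rewrite [ltLHS]/Num.norm /= mx_normrE; apply/bigmax_ltP; split=> //.
by move=> [i j] _; rewrite ord1.
Qed.

Lemma rV_entry_le (R : realType) m (x : 'rV[R]_m) i : `|x 0 i| <= `|x|.
Proof.
rewrite [leRHS]/Num.norm /= mx_normrE.
by apply: (le_bigmax _ (fun ij => `|x ij.1 ij.2|) (0, i)).
Qed.

(** Only the first point is confined to [K]; with [K] a segment of times at one point of space, this
    gives estimates uniform in time. *)
Lemma compact_unif_cont (R : realType) (U V : pseudoMetricType R) (f : U -> V)
    (K : set U) (e : R) : compact K -> (forall x, K x -> continuous_at x f) ->
  0 < e -> exists2 d, 0 < d & forall x y, K x -> ball x d y -> ball (f x) e (f y).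
Proof.
move=> /compact_near_coveringP K_cov cf e0.
have [] := K_cov R (0 : R)^'+ (fun d x => forall y, ball x d y -> ball (f x) e (f y)) _.
  move=> x Kx; have := cf _ Kx _ (nbhsx_ballx (f x) (e / 2) (divr_gt0 e0 (ltr0Sn _ _))).
  rewrite -nbhs_ballE => -[d /= d0 xd].
  exists (ball x (d / 2), [set t | t < d / 2]) => /=.
    split; first by apply: nbhsx_ballx; rewrite divr_gt0.
    by apply: nbhs_right_lt; rewrite divr_gt0.
  move=> [x' t] /= [xx' td] y x'y.
  have xy : ball x d y by apply: ball_split xx' _; apply: le_ball x'y; apply: ltW.
  apply: (@ball_splitr _ _ (f x)); last exact: xd.
  by apply: xd; apply: le_ball xx'; rewrite ler_pdivrMr // ler_peMr ?ler1n // ltW.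
move=> d /= d0 dP; exists (d / 2); first by rewrite divr_gt0.
move=> x y Kx xy; apply: (dP (d / 2)) => //=; last by rewrite divr_gt0.
by rewrite sub0r normrN gtr0_norm ?divr_gt0 // ltr_pdivrMr // ltr_pMr ?ltr1n.
Qed.

Lemma compact_norm_min (R : realType) (U : topologicalType) (V : normedModType R)
    (f : U -> V) (K : set U) :
  compact K -> (forall x, K x -> continuous_at x f) ->
  (forall x, K x -> f x != 0) ->
  exists2 mu : R, 0 < mu & forall x, K x -> mu <= `|f x|.
Proof.
move=> cK cf f0; have [K0|/set0P K0] := eqVneq K set0.
  by exists 1 => // x; rewrite K0.
have [|c cA cP] := compact_EVT_min K0 cK (f := fun x => `|f x|).
  apply: continuous_in_subspaceT => x; rewrite inE => Kx.
  by apply: cont_norm; exact: cf.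
exists `|f c|; first by rewrite normr_gt0 f0 // -inE.
by move=> x Kx; rewrite cP // inE.
Qed.

(** The labels of a fine grid record the signs of the coordinates of [F], which are known on the
    faces of the cube because [F] is the identity there. In the cell given by [kuhn] every
    coordinate of [F] takes both signs, so [F] is smaller there than its minimal norm [mu]. *)
Theorem brouwer_zero (R : realType) m (F : 'rV[R]_m -> 'rV[R]_m) r :
  0 < r -> (forall x, `|x| <= r -> continuous_at x F) ->
  (forall x, `|x| = r -> F x = x) -> exists x, `|x| <= r /\ F x = 0.
Proof.
move=> r0 cF bF; apply: contrapT => /forallNP noz.
pose K := [set x : 'rV[R]_m | `|x| <= r].
have cK : compact K.
  exact: compact_closed_cball.
have [|mu mu0 muF] := compact_norm_min cK (f := F) cF.
  by move=> x Kx; apply/eqP => Fx; apply: (noz x).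
have [|d d0 dF] := compact_unif_cont (f := F) (e := mu / 2) cK cF.
  by rewrite divr_gt0.
pose p := (Num.truncn (2 * r / d)).+1.
have p0 : 0 < p%:R :> R by rewrite ltr0n.
have pd : 2 * r / p%:R < d.
  by rewrite ltr_pdivrMr // (mulrC d) -ltr_pdivrMr //; exact: truncnS_gt.
pose pt (x : 'I_m -> nat) : 'rV[R]_m := \row_j (- r + 2 * r / p%:R * (x j)%:R).
(* [kuhn] wants the boundary labels at all integer points, also outside the grid, hence the two
   explicit clauses. On the grid they agree with the sign of [F]. *)
pose s i x := (x i != 0%N) && ((x i == p) || (0 < F (pt x) 0 i)).
have [||q [qp qP]] := @kuhn m p s.
- by move=> i x E; rewrite /s E eqxx.
- by move=> i x E; rewrite /s E eqxx.
have ptK x : (forall j, x j <= p)%N -> K (pt x).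
  move=> xp; apply: rV_norm_le; first exact: ltW.
  move=> j; rewrite mxE ler_norml lerDl -lerBrDl opprK.
  have -> : r + r = 2 * r / p%:R * p%:R by rewrite divfK ?gt_eqF //; ring.
  have t0 : 0 <= 2 * r / p%:R by rewrite divr_ge0 ?mulr_ge0 // ltW.
  by rewrite mulr_ge0 //= ler_wpM2l // ler_nat.
have ptlo x i : (forall j, x j <= p)%N -> x i = 0%N -> F (pt x) 0 i < 0.
  move=> xp xi; have E : pt x 0 i = - r by rewrite mxE xi mulr0 addr0.
  rewrite bF ?E ?oppr_lt0 //; apply/eqP; rewrite eq_le ptK //=.
  by have := rV_entry_le (pt x) i; rewrite E normrN gtr0_norm.
have pthi x i : (forall j, x j <= p)%N -> x i = p -> 0 < F (pt x) 0 i.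
  move=> xp xi; have E : pt x 0 i = r.
    by rewrite mxE xi divfK ?gt_eqF //; ring.
  rewrite bF ?E //; apply/eqP; rewrite eq_le ptK //=.
  by have := rV_entry_le (pt x) i; rewrite E gtr0_norm.
have close x i : (forall j, q j <= x j <= (q j).+1)%N ->
    `|F (pt q) 0 i - F (pt x) 0 i| < mu / 2.
  move=> qx; have : ball (F (pt q)) (mu / 2) (F (pt x)).
    apply: dF; first by apply: ptK => j; apply: ltnW.
    rewrite -ball_normE /=; apply: rV_norm_lt => // j; rewrite !mxE.
    rewrite opprD opprK addrACA addNr add0r -mulrN -mulrDr normrM.
    rewrite gtr0_norm ?divr_gt0 ?mulr_gt0 //.
    apply: le_lt_trans pd; rewrite ler_piMr //; first by rewrite divr_ge0 // mulr_ge0 // ltW.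
    have /andP[q1 q2] := qx j; rewrite distrC -natrB // normr_nat lern1; lia.
  rewrite -ball_normE /=; apply: le_lt_trans.
  by have := rV_entry_le (F (pt q) - F (pt x)) i; rewrite !mxE.
have : `|F (pt q)| < mu.
  apply: rV_norm_lt => // i; have [y [z [sy sz yP zP]]] := qP i.
  have yp j : (y j <= p)%N by have /andP[_ /leq_trans->] := yP j.
  have zp j : (z j <= p)%N by have /andP[_ /leq_trans->] := zP j.
  have Fy : 0 < F (pt y) 0 i.
    by case/andP: sy => _ /orP[/eqP|//]; exact: pthi.
  have Fz : F (pt z) 0 i <= 0.
    rewrite leNgt; apply: contra sz => Fz; rewrite /s Fz orbT andbT.
    by apply: contraTN Fz => /eqP/(ptlo _ _ zp); rewrite -leNgt; apply: ltW.
  have := close _ i yP; have := close _ i zP; rewrite !ltr_norml.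
  by move=> /andP[? ?] /andP[? ?]; apply/andP; split; lra.
by rewrite ltNge muF //; apply: ptK => j; apply: ltnW.
Qed.

(** * Maps from a lower-dimensional ball *)

(* Inf-convolution with a steep cone. *)
Lemma lipschitz_approx (R : realType) (V : normedModType R) (K : set V)
    (c : V -> R) (e : R) : compact K -> (forall x, K x -> continuous_at x c) ->
  0 < e -> exists (L : R) (g : V -> R), [/\ 0 <= L,
    forall y z, `|g y - g z| <= L * `|y - z| &
    forall y, K y -> `|g y - c y| < e].
Proof.
move=> cK cc e0; have [K0|/set0P K0] := eqVneq K set0.
  by exists 0, (fun=> 0); split=> // [y z|y]; rewrite ?subrr ?normr0 ?mul0r ?K0.
have cwc : {within K, continuous (fun x => `|c x|)}.
  apply: continuous_in_subspaceT => x; rewrite inE => Kx.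
  by apply: cont_norm; exact: cc.
have [m _ mP] := compact_EVT_max K0 cK cwc.
pose B := `|c m|; have cB x : K x -> `|c x| <= B by move=> Kx; rewrite mP ?inE.
have e2 : 0 < e / 2 by rewrite divr_gt0.
have [d d0 dP] := compact_unif_cont cK cc e2.
(* Farther than [d] from [y] a cone of this slope outweighs the oscillation [2 * B] of [c]; nearer,
   [c] varies by less than [e / 2]. *)
pose L := 2 * B / d.
have L0 : 0 <= L by rewrite divr_ge0 ?(ltW d0) // mulr_ge0 // normr_ge0.
pose S y := [set t | exists2 a, K a & t = c a + L * `|y - a|].
have lb y t : S y t -> - B <= t.
  move=> [a Ka ->]; have := cB _ Ka; rewrite ler_norml => /andP[h _].
  by rewrite (le_trans h) // lerDl mulr_ge0.
have S0 y : has_inf (S y).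
  split; last by exists (- B) => t /lb.
  by have [a Ka] := K0; exists (c a + L * `|y - a|), a.
pose g y := inf (S y).
have gle y a : K a -> g y <= c a + L * `|y - a|.
  by move=> Ka; apply: ge_inf; [case: (S0 y)|exists a].
have gge y t : (forall a, K a -> t <= c a + L * `|y - a|) -> t <= g y.
  move=> h; apply: lb_le_inf; first by case: (S0 y).
  by move=> _ [a Ka ->]; exact: h.
have lip y z : g y <= g z + L * `|y - z|.
  rewrite -lerBlDr; apply: gge => a Ka; rewrite lerBlDr.
  rewrite (le_trans (gle y a Ka)) // -addrA lerD2l -mulrDr ler_wpM2l //.
  by rewrite [leRHS]addrC -[y - a](subrKA z) ler_normD.
exists L, g; split=> // [y z|y Ky].
  by rewrite ler_distl lip andbT lerBlDr distrC lip.
have g1 : g y <= c y by rewrite (le_trans (gle y y Ky)) // subrr normr0 mulr0 addr0.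
suff g2 : c y - e / 2 <= g y.
  by rewrite distrC ger0_norm ?subr_ge0 //; lra.
apply: gge => a Ka; case: (ltP `|y - a| d) => ya.
  have := dP y a Ky; rewrite -!ball_normE /= => /(_ ya).
  rewrite ltr_norml => /andP[_ h].
  have := mulr_ge0 L0 (normr_ge0 (y - a)); lra.
have h : 2 * B <= L * `|y - a|.
  by rewrite -[leLHS](divfK (lt0r_neq0 d0)) ler_wpM2l.
have := cB _ Ky; have := cB _ Ka; rewrite !ler_norml.
by move=> /andP[? ?] /andP[? ?]; lra.
Qed.

Lemma natr_dist (R : realType) (a b : nat) : a != b -> 1 <= `|a%:R - b%:R| :> R.
Proof.
wlog ab : a b / (a < b)%N => [h|_].
  by rewrite neq_ltn => /orP[] ab; [|rewrite distrC]; apply: h; rewrite // ltn_eqF.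
by rewrite distrC -natrB ?(ltnW ab) // normr_nat ler1n subn_gt0.
Qed.

(* Counting: a fine grid in the target has more points than there are cells of
   the source, and the image of a cell is too small to contain two of them. *)
Lemma lipschitz_avoid (R : realType) (k m : nat)
    (G : 'rV[R]_k -> 'rV[R]_m) (L b e : R) :
  (k < m)%N -> 0 <= L -> 0 < b -> 0 < e ->
  (forall y z, `|G y - G z| <= L * `|y - z|) ->
  exists2 w, `|w| < e & forall y, `|y| <= b -> G y != w.
Proof.
move=> km L0 b0 e0 lipG; apply: contrapT => nw.
have {}nw w : `|w| < e -> exists y, `|y| <= b /\ G y = w.
  move=> we; apply: contrapT => /forallNP ny; apply: nw; exists w => // y yb.
  by apply/eqP => Gy; apply: (ny y).
pose c := (Num.truncn (2 * b * L / e)).+1.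
have cL : 2 * b * L / e < c%:R by exact: truncnS_gt.
(* The target grid has [P] points per axis at spacing [e / P]. Source cells have side [2 * b / N],
   so their images have diameter at most [2 * b * L / N], which is less than [e / P]. The count is
   contradictory since [(N + 1)^k <= (2 * c)^k * P^k < P^(k + 1) <= P^m]. *)
pose P := ((2 * c) ^ k).+1; pose N := (c * P)%N.
have P0 : 0 < P%:R :> R by rewrite ltr0n.
have N0 : 0 < N%:R :> R by rewrite ltr0n muln_gt0.
pose w (h : {ffun 'I_m -> 'I_P}) : 'rV[R]_m := \row_i (e / P%:R * (h i)%:R).
have we h : `|w h| < e.
  apply: rV_norm_lt => // i; rewrite mxE ger0_norm; last first.
    by rewrite mulr_ge0 // divr_ge0 // ltW.
  by rewrite mulrAC ltr_pdivrMr // ltr_pM2l // ltr_nat ltn_ord.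
pose y h := xget 0 [set y | `|y| <= b /\ G y = w h].
have yP h : `|y h| <= b /\ G (y h) = w h.
  by have := xgetPex 0 (nw _ (we h)).
pose t h i := (y h 0 i + b) / (2 * b) * N%:R.
have t0 h i : 0 <= t h i.
  have /andP[h1 _] : - b <= y h 0 i <= b.
    by rewrite -ler_norml (le_trans (rV_entry_le _ _)) //; case: (yP h).
  by rewrite mulr_ge0 ?divr_ge0 ?mulr_ge0 ?(ltW b0) ?ler0n // -lerBlDr sub0r.
have tN h i : t h i <= N%:R.
  have /andP[_ h1] : - b <= y h 0 i <= b.
    by rewrite -ler_norml (le_trans (rV_entry_le _ _)) //; case: (yP h).
  by rewrite ler_piMl ?ler0n // ler_pdivrMr ?mulr_gt0 // mul1r; lra.
(* The value [N] is attained on the far faces, hence [N.+1] cells per axis. *)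
have tI h i : (Num.truncn (t h i) < N.+1)%N.
  by rewrite ltnS -(ler_nat R) (le_trans _ (tN h i)) // truncn_le.
pose cell h : {ffun 'I_k -> 'I_N.+1} := [ffun i => Ordinal (tI h i)].
have cell_inj : injective cell.
  move=> h h' /ffunP E; apply/ffunP => i; apply: val_inj; apply/eqP.
  have close : `|y h - y h'| <= 2 * b / N%:R.
    apply: rV_norm_le; first by rewrite divr_ge0 ?mulr_ge0 // ltW.
    move=> j; have := E j; rewrite !ffunE => /(congr1 val) /= Ej.
    have h1 : `|t h j - t h' j| <= 1.
      have := truncn_itv (t0 h j); have := truncn_itv (t0 h' j); rewrite Ej.
      rewrite -addn1 natrD ler_norml => /andP[? ?] /andP[? ?].
      by apply/andP; split; lra.
    have -> : (y h - y h') 0 j = (t h j - t h' j) * (2 * b / N%:R).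
      rewrite !mxE /t; field; rewrite !gt_eqF //=.
    have bN : 0 <= 2 * b / N%:R by rewrite divr_ge0 ?mulr_ge0 // ltW.
    by rewrite normrM (ger0_norm bN) ler_piMl.
  have : `|w h - w h'| < e / P%:R.
    have [_ <-] := yP h; have [_ <-] := yP h'.
    apply: (le_lt_trans (lipG _ _)); apply: (le_lt_trans (ler_wpM2l L0 close)).
    rewrite /N natrM invfM mulrA mulrA ltr_pM2r ?invr_gt0 //.
    rewrite ltr_pdivrMr ?ltr0n // -ltr_pdivrMl // mulrC.
    by rewrite (mulrC L).
  move=> wlt; have := le_lt_trans (rV_entry_le (w h - w h') i) wlt.
  rewrite !mxE -mulrBr normrM gtr0_norm ?divr_gt0 //.
  rewrite -ltr_pdivlMl ?divr_gt0 // mulVf; last by rewrite gt_eqF ?divr_gt0.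
  by apply: contraTT => hh; rewrite -leNgt; apply: natr_dist.
have := leq_card cell cell_inj; rewrite !card_ffun !card_ord.
apply/negP; rewrite -ltnNge.
have c0 : (0 < c)%N by [].
have Pk : (P ^ k.+1 <= P ^ m)%N by rewrite leq_exp2l // /P ltnS expn_gt0.
apply: leq_trans Pk; apply: (@leq_ltn_trans ((2 * c * P) ^ k)).
  by case: (k) => // k'; rewrite leq_exp2r // /N; nia.
by rewrite expnMn expnS ltn_pmul2r ?expn_gt0.
Qed.

(** A Lipschitz approximation of each coordinate misses some small value; subtracting that value
    removes the zeros. *)
Lemma nonvanishing_approx (R : realType) (k m : nat)
    (c : 'rV[R]_k -> 'rV[R]_m) (b e : R) :
  (k < m)%N -> 0 < b -> 0 < e ->
  (forall y, `|y| <= b -> continuous_at y c) ->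
  exists2 G : 'rV[R]_k -> 'rV[R]_m, forall y, continuous_at y G &
    forall y, `|y| <= b -> G y != 0 /\ `|G y - c y| < e.
Proof.
move=> km b0 e0 cc; have e2 : 0 < e / 2 by rewrite divr_gt0.
have cK := @compact_closed_cball R k b.
have cj (j : 'I_m) : exists Lg : R * ('rV[R]_k -> R), [/\ 0 <= Lg.1,
    forall y z, `|Lg.2 y - Lg.2 z| <= Lg.1 * `|y - z| &
    forall y, `|y| <= b -> `|Lg.2 y - c y 0 j| < e / 2].
  have [|L [g [? ? ?]]] := lipschitz_approx (c := fun y => c y 0 j) cK _ e2.
    by move=> y yb; apply: cont_coord; exact: cc.
  by exists (L, g).
have {cj} [Lg LgP] := choice cj.
pose L := \sum_j (Lg j).1; pose G0 y : 'rV[R]_m := \row_j (Lg j).2 y.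
have L0 : 0 <= L by apply: sumr_ge0 => j _; case: (LgP j).
have lip y z : `|G0 y - G0 z| <= L * `|y - z|.
  apply: rV_norm_le => [|j]; first by rewrite mulr_ge0.
  rewrite !mxE; have [_ h _] := LgP j; rewrite (le_trans (h _ _)) //.
  rewrite ler_wpM2r // /L (bigD1 j) //= lerDl sumr_ge0 // => i _.
  by case: (LgP i).
have [w we wP] := lipschitz_avoid km L0 b0 e2 lip.
exists (fun y => G0 y - w) => [y|y yb].
  apply: cont_sub; last exact: cont_cst.
  apply: cont_row => j; under eq_fun do rewrite mxE.
  by have [Lj h _] := LgP j; apply: cont_lipschitz Lj h.
split; first by rewrite subr_eq0 wP.
have : `|G0 y - c y| < e / 2.
  by apply: rV_norm_lt => // j; rewrite !mxE; have [_ _] := LgP j; apply.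
move=> h; rewrite addrAC (le_lt_trans (ler_normB _ _)) //; lra.
Qed.

(** * Quadratic germs *)

Definition quad (R : realType) n lam (x : 'rV[R]_n) : R :=
  - \sum_(i < n | (i < lam)%N) x 0 i ^+ 2 + \sum_(i < n | (lam <= i)%N) x 0 i ^+ 2.

(* This truncates when [n < m]. *)
Definition pad (R : realType) m n (x : 'rV[R]_m) : 'rV[R]_n :=
  \row_i oapp (fun j : 'I_m => x 0 j) 0 (insub (val i)).

Section Pad.
Variable R : realType.

Lemma pad_lt m n (x : 'rV[R]_m) (i : 'I_n) (im : (i < m)%N) :
  pad n x 0 i = x 0 (Ordinal im).
Proof. by rewrite mxE insubT. Qed.

Lemma pad_ge m n (x : 'rV[R]_m) (i : 'I_n) : (m <= i)%N -> pad n x 0 i = 0.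
Proof. by move=> im; rewrite mxE insubF // ltnNge im. Qed.

Lemma cont_pad m n (T : topologicalType) (f : T -> 'rV[R]_m) (t : T) :
  continuous_at t f -> continuous_at t (fun s => pad n (f s)).
Proof.
move=> cf; apply: cont_row => i; case: (ltnP i m) => im.
  by under eq_fun do rewrite pad_lt; exact: cont_coord.
by under eq_fun do rewrite pad_ge //; exact: cont_cst.
Qed.

Lemma norm_pad m n (x : 'rV[R]_m) : `|pad n x| <= `|x|.
Proof.
apply: rV_norm_le => // i; case: (ltnP i m) => im.
  by rewrite pad_lt rV_entry_le.
by rewrite pad_ge // normr0.
Qed.

Lemma padK m n (x : 'rV[R]_m) : (m <= n)%N -> pad m (pad n x) = x.
Proof.
move=> mn; apply/rowP => i; have jn : (i < n)%N by rewrite (leq_trans _ mn).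
by rewrite (pad_lt _ jn) (pad_lt _ (i := Ordinal jn) (ltn_ord i)); congr (x 0 _); apply: val_inj.
Qed.

Lemma pad0 m n : pad n (0 : 'rV[R]_m) = 0.
Proof.
apply/rowP => i; rewrite mxE [RHS]mxE.
by case: insub => //= j; rewrite mxE.
Qed.

Lemma quad_pad_lt0 m n (x : 'rV[R]_m) : (m <= n)%N -> x != 0 ->
  quad m (pad n x) < 0.
Proof.
move=> mn x0; rewrite ltNge; apply: contra x0; rewrite /quad [X in _ + X]big1 ?addr0; last first.
  by move=> i im; rewrite pad_ge // expr0n.
rewrite oppr_ge0 => s0; apply/eqP/rowP => i; rewrite mxE.
have jn : (i < n)%N by rewrite (leq_trans _ mn).
have := s0; rewrite (bigD1 (Ordinal jn)) ?ltn_ord //= => h.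
have : pad n x 0 (Ordinal jn) ^+ 2 <= 0.
  by apply: le_trans h; rewrite lerDl sumr_ge0 // => *; rewrite sqr_ge0.
rewrite (pad_lt _ (i := Ordinal jn) (ltn_ord i)) => h1.
have /eqP : x 0 (Ordinal (ltn_ord i)) ^+ 2 = 0 by apply/eqP; rewrite eq_le h1 sqr_ge0.
rewrite sqrf_eq0 => /eqP <-; congr (x 0 _); exact: val_inj.
Qed.

(** Truncation thus sends the region [quad m < 0] into the punctured space. A map of the disc of
    dimension [m] into this region that truncates to the identity on the boundary sphere would
    contradict [brouwer_zero]. *)
Lemma quad_lt0_pad m n (y : 'rV[R]_n) : quad m y < 0 -> pad m y != 0.
Proof.
rewrite ltNge; apply: contraNneq => py; rewrite /quad big1 ?oppr0 ?add0r.
  by rewrite sumr_ge0 // => *; rewrite sqr_ge0.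
move=> i im; have /rowP/(_ (Ordinal im)) := py.
rewrite (pad_lt _ (i := Ordinal im) (ltn_ord i)) mxE => /eqP.
have -> : Ordinal (ltn_ord i) = i by exact: val_inj.
by move=> /eqP ->; rewrite expr0n.
Qed.

End Pad.

(** A germ at 0 together with its inverse. The maps need not preserve the ball, so images have to be
    kept below [d] by hand. *)
Definition local_homeo (R : realType) n (d : R) (k k' : 'rV[R]_n -> 'rV[R]_n) :=
  [/\ 0 < d, k 0 = 0, k' 0 = 0 & forall x, `|x| < d ->
    [/\ continuous_at x k, continuous_at x k', k' (k x) = x & k (k' x) = x]].

Lemma small_at0 (R : realType) n (f : 'rV[R]_n -> 'rV[R]_n) (e : R) :
  continuous_at (0 : 'rV[R]_n) f -> f 0 = 0 -> 0 < e ->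
  exists2 r, 0 < r & forall x, `|x| <= r -> `|f x| < e.
Proof.
move=> cf f0 e0; have := cf _ (nbhsx_ballx (f 0) e e0).
rewrite -nbhs_ballE => -[d /= d0 dP]; exists (d / 2); first by rewrite divr_gt0.
move=> x xd; have : ball (0 : 'rV[R]_n) d x.
  rewrite -ball_normE /= sub0r normrN (le_lt_trans xd) //.
  by rewrite ltr_pdivrMr // ltr_pMr // ltr1n.
by move/dP; rewrite f0 -ball_normE /= sub0r normrN.
Qed.

(* Sliding the small unstable sphere into the half space through the homotopy
   [c] would extend it to the disc inside [quad lam < 0]. *)
Lemma quad_not_linear (R : realType) n lam (d : R) (k k' : 'rV[R]_n -> 'rV[R]_n) (i : 'I_n) :
  (lam <= n)%N -> local_homeo d k k' ->
  (forall x : 'rV[R]_n, `|x| < d -> quad lam x = k x 0 i) ->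
  (forall x : 'rV[R]_n, `|x| < d -> quad lam (k' x) = x 0 i) -> False.
Proof.
move=> ln [d0 k0 k'0 kP] qk qk'.
have d4 : 0 < d / 4 by rewrite divr_gt0.
have [c0 _ _ _] : [/\ continuous_at (0 : 'rV[R]_n) k, continuous_at (0 : 'rV[R]_n) k', k' (k 0) = 0 & k (k' 0) = 0].
  by apply: kP; rewrite normr0.
have [r1 r10 r1P] := small_at0 c0 k0 d4.
pose r := Num.min r1 (d / 4).
have r0 : 0 < r by rewrite lt_min r10 d4.
have rr1 : r <= r1 by rewrite ge_min lexx.
have rd : r <= d / 4 by rewrite ge_min lexx orbT.
(* On the sphere this is [k (pad n x)]. Inside, the shift makes coordinate [i] negative even at the
   centre, where the quadratic form vanishes. *)
pose c (x : 'rV[R]_lam) := k (pad n x) - (r - `|x|) *: delta_mx 0 i.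
have ne : `|delta_mx 0 i : 'rV[R]_n| <= 1.
  by apply: rV_norm_le => // j; rewrite mxE; case: eqP; case: eqP; rewrite ?normr1 ?normr0.
have pd (x : 'rV[R]_lam) : `|x| <= r -> `|pad n x| < d.
  by move=> xr; rewrite (le_lt_trans (norm_pad _ _)) //; lra.
have cd x : `|x| <= r -> `|c x| < d.
  move=> xr; rewrite (le_lt_trans (ler_normB _ _)) // normrZ.
  have h1 : `|k (pad n x)| < d / 4.
    by apply: r1P; rewrite (le_trans (norm_pad _ _)) // (le_trans xr).
  have h2 : `|r - `|x| | <= r by rewrite ger0_norm ?subr_ge0 // gerBl.
  have := ler_pM (normr_ge0 _) (normr_ge0 _) h2 ne; lra.
have [|x xr|x [xr Fx]] := @brouwer_zero R lam (fun x => pad lam (k' (c x))) r r0.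
- move=> x xr; apply: cont_pad; apply: cont_comp.
    apply: cont_sub; first apply: cont_comp.
    + by apply: cont_pad; exact: cont_id.
    + by case: (kP _ (pd _ xr)).
    apply: cont_scale; last exact: cont_cst.
    apply: (contB R); first exact: cont_cst.
    by apply: cont_norm; exact: cont_id.
  by case: (kP _ (cd _ xr)).
- have xr' : `|x| <= r by rewrite xr.
  rewrite /c xr subrr scale0r subr0.
  by have [_ _ -> _] := kP _ (pd _ xr'); rewrite padK.
have : quad lam (k' (c x)) < 0.
  rewrite qk' ?cd // !mxE -qk ?pd // !eqxx mulr1.
  case: (eqVneq x 0) => [->|x0]; first by rewrite pad0 /quad normr0 subr0 !big1 //; first lra;
    by move=> j _; rewrite mxE expr0n.
  by have := quad_pad_lt0 ln x0; lra.
by move/quad_lt0_pad; rewrite Fx eqxx.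
Qed.

(** For [t] from 0 to 1 this deforms the region [quad nu < 0] within itself onto its part in the
    first [nu] coordinates. *)
Definition squeeze (R : realType) n nu (t : R) (x : 'rV[R]_n) : 'rV[R]_n :=
  \row_i (if (i < nu)%N then x 0 i else (1 - t) * x 0 i).

Section Squeeze.
Variables (R : realType) (n nu : nat).
Implicit Types (x : 'rV[R]_n) (t : R).

Lemma squeeze0 x : squeeze nu 0 x = x.
Proof. by apply/rowP => i; rewrite mxE subr0 mul1r; case: ifP. Qed.

Lemma squeeze1 x : squeeze nu 1 x = pad n (pad nu x).
Proof.
apply/rowP => i; rewrite mxE subrr mul0r; case: ltnP => inu; last by rewrite pad_ge.
rewrite pad_lt (pad_lt _ (i := Ordinal inu) (ltn_ord i)).
by congr (x 0 _); apply: val_inj.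
Qed.

Lemma norm_squeeze t x : 0 <= t <= 1 -> `|squeeze nu t x| <= `|x|.
Proof.
move=> /andP[t0 t1]; apply: rV_norm_le => // i; rewrite mxE.
case: ifP => _; first exact: rV_entry_le.
rewrite normrM ger0_norm ?subr_ge0 // (le_trans _ (rV_entry_le x i)) //.
by rewrite ler_piMl // gerBl.
Qed.

Lemma quad_squeeze t x : 0 <= t <= 1 -> quad nu (squeeze nu t x) <= quad nu x.
Proof.
move=> /andP[t0 t1]; apply: lerD; last first.
  apply: ler_sum => i ni; rewrite mxE ltnNge ni /= exprMn.
  by rewrite ler_piMl ?sqr_ge0 // expr_le1 // ?subr_ge0 // gerBl.
by rewrite lerN2; apply: ler_sum => i ni; rewrite mxE ni.
Qed.

Lemma cont_squeeze (T : topologicalType) (u : T) (t : T -> R) (f : T -> 'rV[R]_n) :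
  continuous_at u t -> continuous_at u f ->
  continuous_at u (fun s => squeeze nu (t s) (f s)).
Proof.
move=> ct cf; apply: cont_row => i; under eq_fun do rewrite mxE.
case: ifP => _; first exact: cont_coord.
apply: (@contM R T u (fun s => 1 - t s) (fun s => f s 0 i)); last exact: cont_coord.
by apply: (contB R) => //; exact: cont_cst.
Qed.

End Squeeze.

(* On shells of the disc of [R^lam], from the outside in: the second group of
   coordinates of [k] is squeezed to [0]; then the map [R^nu -> R^lam] obtained
   is traded for an approximation [G] without zeros, which exists since
   [nu < lam]. *)
Lemma quad_index_le (R : realType) n nu lam (d : R) (k k' : 'rV[R]_n -> 'rV[R]_n) :
  (lam <= n)%N -> local_homeo d k k' ->
  (forall x : 'rV[R]_n, `|x| < d -> quad lam x = quad nu (k x)) ->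
  (forall x : 'rV[R]_n, `|x| < d -> quad lam (k' x) = quad nu x) -> (lam <= nu)%N.
Proof.
move=> ln [d0 k0 k'0 kP] qk qk'; rewrite leqNgt; apply/negP => nl.
pose b := d / 2; have b0 : 0 < b by rewrite divr_gt0.
have bd : b < d by rewrite ltr_pdivrMr // ltr_pMr // ltr1n.
have [c0 _ _ _] : [/\ continuous_at (0 : 'rV[R]_n) k, continuous_at (0 : 'rV[R]_n) k', k' (k 0) = 0 & k (k' 0) = 0].
  by apply: kP; rewrite normr0.
have [r1 r10 r1P] := small_at0 c0 k0 b0.
pose r := Num.min r1 b.
have r0 : 0 < r by rewrite lt_min r10 b0.
have rr1 : r <= r1 by rewrite ge_min lexx.
have rb : r <= b by rewrite ge_min lexx orbT.
pose c (x : 'rV[R]_lam) := k (pad n x).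
have pd (x : 'rV[R]_lam) : `|x| <= r -> `|pad n x| < d.
  by move=> xr; rewrite (le_lt_trans (norm_pad _ _)) //; lra.
have cb x : `|x| <= r -> `|c x| < b.
  by move=> xr; apply: r1P; rewrite (le_trans (norm_pad _ _)) // (le_trans xr).
have cc x : `|x| <= r -> continuous_at x c.
  move=> xr; apply: cont_comp; first by apply: cont_pad; exact: cont_id.
  by case: (kP _ (pd _ xr)).
have qc x : `|x| <= r -> x != 0 -> quad nu (c x) < 0.
  by move=> xr x0; rewrite -qk ?pd // quad_pad_lt0.
pose f (x : 'rV[R]_lam) t := pad lam (k' (squeeze nu t (c x))).
have sd x t : `|x| <= r -> 0 <= t <= 1 -> `|squeeze nu t (c x)| < d.
  by move=> xr t01; rewrite (le_lt_trans (norm_squeeze _ _ _)) // (lt_trans (cb _ xr)).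
have f0 x t : `|x| <= r -> x != 0 -> 0 <= t <= 1 -> f x t != 0.
  move=> xr x0 t01; apply: quad_lt0_pad; rewrite qk' ?sd //.
  by rewrite (le_lt_trans (quad_squeeze _ _ _)) ?qc.
have cf x (t : 'rV[R]_lam -> R) : `|x| <= r -> 0 <= t x <= 1 -> continuous_at x t ->
    continuous_at x (fun y => f y (t y)).
  move=> xr t01 ct; apply: cont_pad; apply: cont_comp.
    by apply: cont_squeeze => //; exact: cc.
  by case: (kP _ (sd _ _ xr t01)).
(* The centre is left out because [f] vanishes there. *)
pose A := [set x : 'rV[R]_lam | `|x| <= r] `&` [set x | r / 3 <= `|x|].
have cA : compact A.
  apply: compact_closedI; first exact: compact_closed_cball.
  apply: (@closed_comp _ _ (fun y : 'rV[R]_lam => `|y|) [set t | r / 3 <= t]); last exact: closed_ge.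
  by move=> y _; exact: norm_continuous.
have [||mu mu0 muP] := compact_norm_min cA (f := fun x => f x 1).
- by move=> x [xr _]; apply: (cf x (fun=> 1)) => //; [rewrite ler01 lexx|exact: cont_cst].
- move=> x [xr xr3]; apply: f0 => //; last by rewrite ler01 lexx.
  by rewrite -normr_gt0 (lt_le_trans _ xr3) // divr_gt0.
(* At [t = 1] the map [f] factors through [R^nu]; the precision [mu] keeps the segment from [f x 1]
   to the value of [G] away from 0. *)
have [|G cG GP] := nonvanishing_approx (c := fun y => pad lam (k' (pad n y))) nl b0 mu0.
  move=> y yb; apply: cont_pad; apply: cont_comp; first by apply: cont_pad; exact: cont_id.
  have h : `|pad n y| < d by rewrite (le_lt_trans (norm_pad _ _)) // (le_lt_trans yb).
  by case: (kP _ h).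
(* [t1] grows from 0 to 1 as the norm falls from [r] to [2 * r / 3], and [t2] does so from
   [2 * r / 3] to [r / 3]; inside, [F] is given by [G] alone. *)
pose t1 (x : 'rV[R]_lam) := Num.min 1 (3 - 3 * (`|x| / r)).
pose t2 (x : 'rV[R]_lam) := Num.max 0 (Num.min 1 (2 - 3 * (`|x| / r))).
pose F x := (1 - t2 x) *: f x (t1 x) + t2 x *: G (pad nu (c x)).
have t101 x : `|x| <= r -> 0 <= t1 x <= 1.
  move=> xr; rewrite le_min ler01 ge_min lexx /= andbT subr_ge0 ler_piMr //.
  by rewrite ler_pdivrMr // mul1r.
have cnr x : continuous_at x (fun y : 'rV[R]_lam => 3 * (`|y| / r)).
  apply: (contM R); first exact: cont_cst.
  apply: (contM R); last exact: cont_cst.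
  by apply: cont_norm; exact: cont_id.
have ct1 x : continuous_at x t1.
  by apply: (cont_min R); [|apply: (contB R) => //]; exact: cont_cst.
have ct2 x : continuous_at x t2.
  apply: (cont_max R); first exact: cont_cst.
  by apply: (cont_min R); [|apply: (contB R) => //]; exact: cont_cst.
have [|x xr|x [xr Fx]] := @brouwer_zero R lam F r r0.
- move=> x xr; apply: cont_add; apply: cont_scale => //.
  + by apply: (contB R) => //; exact: cont_cst.
  + by apply: cf => //; exact: t101.
  + apply: (cont_comp (g := G)); last exact: cG.
    by apply: cont_pad; exact: cc.
- have xr' : `|x| <= r by rewrite xr.
  have u1 : `|x| / r = 1 by rewrite xr divff ?gt_eqF.
  have t1x : t1 x = 0 by rewrite /t1 u1 mulr1 subrr min_r.
  have t2x : t2 x = 0 by rewrite /t2 u1 mulr1 max_l // ge_min; apply/orP; right; lra.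
  rewrite /F t1x t2x.
  rewrite subr0 scale1r scale0r addr0 /f squeeze0.
  by have [_ _ -> _] := kP _ (pd _ xr'); rewrite padK.
have Gb : `|pad nu (c x)| <= b by rewrite (le_trans (norm_pad _ _)) // ltW // cb.
have [Gx0 Gx] := GP _ Gb.
case: (leP (`|x| / r) (1 / 3)) => u1.
  move: Fx; rewrite /F; have -> : t2 x = 1.
    by rewrite /t2 min_l ?max_r //; lra.
  by rewrite subrr scale0r add0r scale1r; exact/eqP.
have x0 : x != 0 by apply: contraTneq u1 => ->; rewrite normr0 mul0r -leNgt divr_ge0.
case: (leP (2 / 3) (`|x| / r)) => u2.
  move: Fx; rewrite /F; have -> : t2 x = 0.
    by rewrite /t2 max_l // ge_min; apply/orP; right; lra.
  rewrite subr0 scale1r scale0r addr0; apply/eqP; apply: f0 => //; exact: t101.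
have t11 : t1 x = 1 by rewrite /t1 min_l //; lra.
have t2_0 : 0 <= t2 x by rewrite /t2 le_max lexx.
have t2_1 : t2 x <= 1 by rewrite /t2 ge_max ler01 ge_min lexx.
have muf : mu <= `|f x 1|.
  by apply: muP; split => //=; rewrite mulrC -ler_pdivlMr //; lra.
have : `|t2 x *: (G (pad nu (c x)) - f x 1)| < mu.
  rewrite normrZ ger0_norm // (le_lt_trans _ Gx) // /f squeeze1.
  by rewrite ler_piMl.
rewrite ltNge (le_trans muf) //.
have -> : t2 x *: (G (pad nu (c x)) - f x 1) = F x - f x 1.
  by rewrite /F t11 scalerBr scalerBl scale1r [RHS]addrC addrA addKr addrC.
by rewrite Fx sub0r normrN.
Qed.

(** * Lyapunov functions *)

(** The series of the functions [g k] with weights [2^-(k + 1)], written as a supremum of partial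
    sums. *)
Lemma weighted_sum (R : realType) (T : topologicalType) (g : nat -> T -> R) :
  (forall k x, continuous_at x (g k)) -> (forall k x, 0 <= g k x <= 1) ->
  exists2 phi : T -> R, forall x, continuous_at x phi &
    forall x y k, (forall j, g j y <= g j x) -> g k y < g k x -> phi y < phi x.
Proof.
move=> cg g01; pose w k : R := 2^-1 ^+ k.
have w0 k : 0 < w k by rewrite exprn_gt0.
have wS k : w k = 2 * w k.+1 by rewrite /w exprS mulrA divff ?mul1r.
pose S N x := \sum_(k < N) w k.+1 * g k x.
have SS N x : S N.+1 x = S N x + w N.+1 * g N x by rewrite /S big_ord_recr.
have gle k x : w k.+1 * g k x <= w k.+1.
  by rewrite ler_piMr ?(ltW (w0 _)) //; case/andP: (g01 k x).
have gge k x : 0 <= w k.+1 * g k x.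
  by rewrite mulr_ge0 ?(ltW (w0 _)) //; case/andP: (g01 k x).
(* [S N + w N] does not increase with [N], which confines the limit between [S N] and [S N + w N]
   and makes the convergence uniform. *)
have Sup N m x : S (N + m)%N x + w (N + m)%N <= S N x + w N.
  elim: m => [|m IH]; first by rewrite addn0.
  apply: le_trans IH; rewrite addnS SS (wS (N + m)%N).
  have := gle (N + m)%N x; lra.
have Sge N m x : S N x <= S (N + m)%N x.
  elim: m => [|m IH]; first by rewrite addn0.
  by rewrite addnS SS (le_trans IH) // lerDl.
pose P x := [set t | exists N, t = S N x].
have Pub N x t : P x t -> t <= S N x + w N.
  move=> [m ->]; case: (leqP N m) => Nm.
    by rewrite -(subnKC Nm) (le_trans _ (Sup _ (m - N)%N _)) // lerDl ltW.
  by rewrite (le_trans (Sge _ (N - m)%N _)) // subnKC ?(ltnW Nm) // lerDl ltW.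
have PS x : has_sup (P x).
  by split; [exists (S 0%N x), 0%N | exists (S 0%N x + w 0%N) => t; exact: Pub].
pose phi x := sup (P x).
have phige N x : S N x <= phi x.
  by apply: sup_upper_bound => //; exists N.
have phile N x : phi x <= S N x + w N.
  by apply: sup_le_ub; [case: (PS x)|move=> t; exact: Pub].
have cS N x : continuous_at x (S N).
  apply: (cont_sum R) => k _; apply: (contM R); first exact: cont_cst.
  exact: cg.
exists phi => [x|x y k gyx gk].
  apply/cvgrPdist_lt => e e0.
  have [N wN] : exists N, w N < e / 2.
    exists (Num.truncn (2 / e)).+1; set N := _.+1.
    rewrite /w exprVn invf_plt ?posrE ?exprn_gt0 ?divr_gt0 // invf_div.
    apply: (@lt_trans _ _ N%:R); first exact: truncnS_gt.
    by rewrite -natrX ltr_nat ltn_expl.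
  have := cS N x => /cvgrPdist_lt/(_ (e / 2)); rewrite divr_gt0 // => /(_ isT).
  apply: filterS => y; rewrite !ltr_norml => /andP[? ?].
  have := phige N x; have := phige N y; have := phile N x; have := phile N y.
  move=> ? ? ? ?; apply/andP; split; lra.
have gap : 0 < w k.+1 * (g k x - g k y) by rewrite mulr_gt0 // subr_gt0.
rewrite -subr_gt0; apply: (lt_le_trans gap).
rewrite lerBrDr -lerBrDl; apply: sup_le_ub; first by case: (PS y).
move=> _ [N ->]; apply: (le_trans (Sge N k.+1 y)).
rewrite lerBrDl; apply: le_trans (phige (N + k.+1)%N x).
have kN : (k < N + k.+1)%N by rewrite addnS ltnS leq_addl.
rewrite /S (bigD1 (Ordinal kN)) //= [leRHS](bigD1 (Ordinal kN)) //=.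
rewrite addrA -mulrDr subrK lerD2l; apply: ler_sum => j _.
by rewrite ler_wpM2l ?(ltW (w0 _)).
Qed.

(** * Chain reachability and attractor blocks *)

Section Flow.
Variables (R : realType) (M : metricType R) (f : R -> M -> M).
Hypothesis flow_f : topological_flow f.
Implicit Types (x y z : M) (t s : R).

Lemma flow0 x : f 0 x = x. Proof. by case: flow_f. Qed.

Lemma flowD t s x : f t (f s x) = f (t + s) x. Proof. by case: flow_f. Qed.

Lemma flowK t x : f (- t) (f t x) = x.
Proof. by rewrite flowD addNr flow0. Qed.

Lemma flowNK t x : f t (f (- t) x) = x.
Proof. by rewrite flowD addrN flow0. Qed.

Lemma cont_flow (T : topologicalType) (u : T) (a : T -> R) (g : T -> M) :
  continuous_at u a -> continuous_at u g ->
  continuous_at u (fun q => f (a q) (g q)).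
Proof.
move=> ca cg; have [cf _ _] := flow_f.
apply: (cont_comp (f := fun q => (a q, g q)) (g := fun tx : R * M => f tx.1 tx.2)).
  exact: cont_pair.
exact: cf.
Qed.

Definition reach (e : R) x : set M := [set y | exists T, epsilon_chain f e T x y].

(** Splits off the last step of a chain. The case [w = x] is a chain with a single step, since empty
    chains are not allowed. *)
Lemma reachP e x y : reach e x y <-> exists w t,
  [/\ w = x \/ reach e x w, 1 <= t & mdist (f t w) y < e].
Proof.
split=> [[T [m [xs [ts [m0 xs0 xsm step _]]]]]|[w [t [wx t1 wy]]]].
  case: m m0 xsm step => // m _ xsm step.
  exists (xs m), (ts m.+1); have [|t1 d1] := step m.+1; first by rewrite /= leqnn.
  split=> //; last by rewrite -xsm.
  case: m xsm step {t1 d1} => [|m] xsm step; first by left.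
  right; exists (\sum_(1 <= i < m.+2) ts i); exists m.+1, xs, ts; split=> // i.
  by move=> /andP[i1 im]; apply: step; rewrite i1 ltnW.
case: wx => [wE|[T [m [xs [ts [m0 xs0 xsm step _]]]]]].
  exists (\sum_(1 <= i < 2) t), 1%N, (fun i => if i is 0%N then x else y), (fun=> t).
  by split=> // i; rewrite -eqn_leq => /eqP <- /=; rewrite -wE.
exists (\sum_(1 <= i < m.+2) (if (i <= m)%N then ts i else t)), m.+1.
exists (fun i => if (i <= m)%N then xs i else y), (fun i => if (i <= m)%N then ts i else t).
split=> //; first by rewrite ltnn.
move=> i /andP[i1 im]; case: (leqP i m) => h.
  by rewrite (leq_trans (leq_pred i)) //; apply: step; rewrite i1.
have -> : i = m.+1 by apply/eqP; rewrite eqn_leq im.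
by rewrite /= leqnn xsm.
Qed.

Lemma reach_open e x : open (reach e x).
Proof.
rewrite openE => y /reachP[w [t [wx t1 wy]]].
have d0 : 0 < e - mdist (f t w) y by rewrite subr_gt0.
apply: filterS (nbhsx_ballx y _ d0) => z; rewrite ballEmdist /= => yz.
apply/reachP; exists w, t; split=> //.
by rewrite (le_lt_trans (metric_triangle _ y _)) // -ltrBrDl.
Qed.

(** A reachable point close to [y] has an image within [e] of [f t y], which is one more step of a
    chain. Hence the reachable set is an attractor block, though only for times at least 1. *)
Lemma reach_flow e x y t : 0 < e -> 1 <= t -> closure (reach e x) y ->
  reach e x (f t y).
Proof.
move=> e0 t1 cly.
have cf : continuous_at y (f t) by apply: cont_flow; [exact: cont_cst|exact: cont_id].
have [z [xz]] := cly _ (cf _ (nbhsx_ballx _ _ e0)).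
move=> /= /ball_sym; rewrite ballEmdist /= => h; apply/reachP; exists z, t; split=> //.
by right.
Qed.

(* With [u] equal to [0] on the image of the block at time [1] and to [1] off the
   block, the supremum of [u] over the whole forward orbit is attained on the
   time interval [0, 2], hence is continuous. *)
Lemma attractor_function x : ~ chain_recurrent_set f x ->
  exists v : M -> R, [/\ forall y, continuous_at y v, forall y, 0 <= v y <= 1,
    forall y t, 0 <= t -> v (f t y) <= v y & v (f 2 x) < v x].
Proof.
move=> /existsNP[e /not_implyP[e0 nx]].
pose U := reach e x; have Ux : ~ U x by move=> [T xx]; apply: nx; exists T.
have Uf1 : U (f 1 x).
  by apply/reachP; exists x, 1; split; [left| |rewrite mdistxx].
pose A := [set y | closure U (f (-1) y)].
have cf t y : continuous_at y (f t) by apply: cont_flow; [exact: cont_cst|exact: cont_id].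
have AU y : A y -> U y.
  by move=> /(reach_flow e0 (lexx 1)); rewrite flowNK.
have [u [cu u01 uA uB]] : exists u : M -> R, [/\ continuous u, range u `<=` `[0, 1],
    u @` A `<=` [set 0] & u @` (~` U) `<=` [set 1]].
  apply/uniform_separatorP; have /(@normal_separatorP R) := @pseudometric_normal R M.
  apply.
  - apply: closed_comp; last exact: closed_closure.
    by move=> y _; exact: cf.
  - by apply: open_closedC; exact: reach_open.
  - by apply/seteqP; split=> // y [/AU].
have {}u01 y : 0 <= u y <= 1 by have := u01 (u y) (ex_intro2 _ _ y I erefl); rewrite /= in_itv.
have {}uA y : A y -> u y = 0 by move=> Ay; apply: uA; exists y.
have {}uB y : ~ U y -> u y = 1 by move=> Uy; apply: uB; exists y.
pose S y := [set r | exists2 t : R, 0 <= t <= 2 & r = u (f t y)].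
have i0 : 0 <= (0 : R) <= 2 by apply/andP; split; lra.
have Sub y r : S y r -> r <= 1 by move=> [t _ ->]; case/andP: (u01 (f t y)).
have SS y : has_sup (S y).
  by split; [exists (u (f 0 y)), 0 | exists 1 => r; exact: Sub].
pose v y := sup (S y).
have vge y t : 0 <= t <= 2 -> u (f t y) <= v y.
  by move=> t02; apply: sup_upper_bound => //; exists t.
have vle y r : (forall t, 0 <= t <= 2 -> u (f t y) <= r) -> v y <= r.
  by move=> h; apply: sup_le_ub; [case: (SS y) | move=> _ [t t02 ->]; exact: h].
have v0 y : 0 <= v y by rewrite (le_trans _ (vge y 0 i0)) //; case/andP: (u01 (f 0 y)).
(* An orbit starting in [U] lies in [A] from time 2 on, where [u] is 0; one starting off [U] has the
   maximal value 1 at time 0. *)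
have uv y t : 0 <= t -> u (f t y) <= v y.
  move=> t0; case: (leP t 2) => t2; first by apply: vge; rewrite t0.
  have [Uy|/uB uy] := pselect (U y); last first.
    by rewrite (le_trans _ (vge y 0 i0)) // flow0 uy; case/andP: (u01 (f t y)).
  rewrite uA //; rewrite /A /= flowD; apply: subset_closure.
  by apply: reach_flow => //; [lra | exact: subset_closure].
exists v; split.
- move=> y; apply/cvgrPdist_lt => r r0; have r2 : 0 < r / 2 by rewrite divr_gt0.
  pose g (tx : R * M) := u (f tx.1 tx.2).
  have cK : compact (`[0, 2]%classic `*` [set y] : set (R * M)).
    by apply: compact_setX; [exact: segment_compact|exact: compact_set1].
  have [|d d0 dP] := compact_unif_cont (f := g) cK _ r2.
    move=> tx _; apply: (cont_comp (f := fun tx : R * M => f tx.1 tx.2)); last exact: cu.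
    by case: flow_f.
  apply: filterS (nbhsx_ballx y _ d0) => z yz.
  have close t : 0 <= t <= 2 -> `|u (f t y) - u (f t z)| < r / 2.
    move=> t02; have := dP (t, y) (t, z); rewrite -ball_normE; apply.
      by split=> //=; rewrite in_itv.
    by split=> //=; exact: ballxx.
  have h1 : v y <= v z + r / 2.
    apply: vle => t t02; have := close t t02; have := vge z t t02.
    rewrite ltr_norml => ? /andP[? ?]; lra.
  have h2 : v z <= v y + r / 2.
    apply: vle => t t02; have := close t t02; have := vge y t t02.
    rewrite ltr_norml => ? /andP[? ?]; lra.
  by rewrite ltr_norml; apply/andP; split; lra.
- by move=> y; rewrite v0 /=; apply: vle => t _; case/andP: (u01 (f t y)).
- by move=> y t t0; apply: vle => s /andP[s0 _]; rewrite flowD; apply: uv; rewrite addr_ge0.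
(* From time 1 on the orbit of [x] is in [U], hence from time 2 on it is in [A]; but [x] itself is
   off [U], not being reachable from itself. *)
- have -> : v (f 2 x) = 0.
    apply/le_anti; rewrite v0 andbT; apply: vle => t /andP[t0 _]; rewrite uA //.
    rewrite /A /= !flowD; have -> : -1 + t + 2 = t + 1 by ring.
    apply: subset_closure; case: (leP 1 t) => t1.
      by rewrite -flowD; apply: reach_flow => //; exact: subset_closure.
    apply/reachP; exists x, (t + 1); split; [by left | lra | by rewrite mdistxx].
  by rewrite (lt_le_trans ltr01) // (le_trans _ (vge x 0 i0)) // flow0 uB.
Qed.

End Flow.

Lemma lt_fun_open (R : realType) (T : topologicalType) (g h : T -> R) :
  (forall x, continuous_at x g) -> (forall x, continuous_at x h) ->
  open [set x | g x < h x].
Proof.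
move=> cg ch; have -> : [set x | g x < h x] = (fun x => h x - g x) @^-1` [set r | 0 < r].
  by apply/seteqP; split=> x /=; rewrite subr_gt0.
apply: open_comp; last exact: open_gt.
by move=> x _; exact: contB (ch x) (cg x).
Qed.

(** The near-covering form of compactness, applied to the filter of lists that contain a given
    list. *)
Lemma compact_seq_cover (T : topologicalType) (J : eqType) (K : set T) (g : J -> set T) :
  compact K -> (forall x, K x -> exists a, nbhs x (g a)) ->
  exists s : seq J, forall x, K x -> exists2 a, a \in s & g a x.
Proof.
move=> /compact_near_coveringP cK gK.
pose F : set_system (seq J) := filter_from setT (fun s0 : seq J => [set s : seq J | {subset s0 <= s}]).
have FF : Filter F.
  apply: filter_from_filter; first by exists [::].
  move=> s t _ _; exists (s ++ t) => // u /= stu.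
  by split=> a ai; apply: stu; rewrite mem_cat ai ?orbT.
have [x Kx|s _ sP] := cK _ F (fun s x => exists2 a, a \in s & g a x) FF.
  have [a gax] := gK _ Kx; exists (g a, [set s : seq J | {subset [:: a] <= s}]).
    by split=> //; exists [:: a].
  by move=> [y s] /= [gy as_]; exists a => //; apply: as_; rewrite mem_head.
by exists s => x Kx; apply: (sP s).
Qed.

(** Without any drop, [v] would never fall below [v y] at the multiples of [t], against the drop
    before time 2. Being an open condition on the shift, the drop also occurs at a rational one. *)
Lemma strictly_decreasing_at_rat (R : realType) (M : metricType R) (f : R -> M -> M)
    (v : M -> R) (y : M) (t : R) : topological_flow f ->
  (forall x, continuous_at x v) -> (forall x s, 0 <= s -> v (f s x) <= v x) ->
  v (f 2 y) < v y -> 0 < t ->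
  exists r : rat, v (f (ratr r) (f t y)) < v (f (ratr r) y).
Proof.
move=> flow_f cv mv vy t0.
have [r rP] : exists r : R, v (f r (f t y)) < v (f r y).
  apply: contrapT => /forallNP N.
  have h k : v y <= v (f (k%:R * t) y).
    elim: k => [|k IH]; first by rewrite mul0r (flow0 flow_f).
    apply: (le_trans IH); have /negP := N (k%:R * t).
    by rewrite -leNgt (flowD flow_f) -[X in _ + X]mul1r -mulrDl natr1.
  pose k := (Num.truncn (2 / t)).+1.
  have kt : 2 <= k%:R * t by rewrite -ler_pdivrMr // ltW //; exact: truncnS_gt.
  have : v (f (k%:R * t) y) < v y.
    apply: le_lt_trans vy; have -> : k%:R * t = (k%:R * t - 2) + 2 by rewrite subrK.
    by rewrite -(flowD flow_f) mv // subr_ge0.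
  by rewrite ltNge h.
pose O := [set r : R | v (f r (f t y)) < v (f r y)].
have oO : open O.
  have cr z (s : R) : continuous_at s (fun r => v (f r z)).
    apply: (cont_comp (f := fun r => f r z)); last exact: cv.
    by apply: (cont_flow flow_f); [exact: cont_id|exact: cont_cst].
  by apply: lt_fun_open => s; exact: cr.
have [z [/= Oz [q _ qz]]] := @dense_rat R O (ex_intro _ r rP) oO.
by exists q; rewrite qz.
Qed.

Theorem lyapunov_exists (R : realType) (M : metricType R) (f : R -> M -> M) :
  compact [set: M] -> topological_flow f -> closed (chain_recurrent_set f) ->
  exists phi : M -> R, continuous phi /\
    forall x, ~ chain_recurrent_set f x -> forall t, 0 < t -> phi (f t x) < phi x.
Proof.
move=> cM flow_f clC; pose C := chain_recurrent_set f.
pose good (v : M -> R) := [/\ forall y, continuous_at y v, forall y, 0 <= v y <= 1 &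
    forall y t, 0 <= t -> v (f t y) <= v y].
have good0 : good (fun=> 0).
  by split=> *; [exact: cont_cst|rewrite lexx ler01|].
(* A compact exhaustion of the complement of [C]. Each piece needs only finitely many attractor
   functions, so countably many suffice. *)
pose K (m : nat) := [set y | forall c, C c -> ~ (ball c (m.+1%:R^-1 : R))° y].
have Kex y : ~ C y -> exists m, K m y.
  move=> Cy; have : nbhs y (~` C) by apply: open_nbhs_nbhs; split=> //; exact: closed_openC.
  rewrite -nbhs_ballE => -[d /= d0 dP]; exists (Num.truncn d^-1) => c Cc /interior_subset yc.
  apply: (dP c) => //; apply: ball_sym; apply: le_ball yc.
  by rewrite invf_ple ?posrE // ltW //; exact: truncnS_gt.
have KC m : K m `<=` ~` C.
  by move=> y Ky Cy; apply: (Ky y Cy); apply: nbhsx_ballx.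
have cK m : compact (K m).
  apply: (subclosed_compact _ cM) => //.
  have -> : K m = \bigcap_(c in C) ~` (ball c (m.+1%:R^-1 : R))°.
    by apply/seteqP; split=> y Ky c Cc; exact: (Ky c Cc).
  by apply: closed_bigI => c _; apply: open_closedC; exact: open_interior.
have FP m : exists F : seq (M -> R), (forall j, good (nth (fun=> 0) F j)) /\
    forall y, K m y -> exists j, nth (fun=> 0) F j (f 2 y) < nth (fun=> 0) F j y.
  have vP x : exists v : M -> R, good v /\ (~ C x -> v (f 2 x) < v x).
    have [Cx|/(attractor_function flow_f)] := pselect (C x).
      by exists (fun=> 0).
    by move=> [v [? ? ? ?]]; exists v.
  have {vP} [v vP] := choice vP.
  have [|s sP] := @compact_seq_cover M M (K m) (fun x => [set y | v x (f 2 y) < v x y]) (cK m).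
    move=> y /KC Cy; exists y; have [[cv _ _] vy] := vP y.
    apply: open_nbhs_nbhs; split; last exact: vy.
    apply: lt_fun_open => // z; apply: (cont_comp (f := f 2)); last exact: cv.
    by apply: (cont_flow flow_f); [exact: cont_cst|exact: cont_id].
  exists [seq v x | x <- s]; split=> [j|y /sP [x xs xy]].
    case: (ltnP j (size s)) => js; last by rewrite nth_default ?size_map.
    have [x0 _] : exists x0 : M, True by case: s js {sP} => // x0; exists x0.
    by rewrite (nth_map x0) //; case: (vP (nth x0 s j)).
  by exists (index x s); rewrite (nth_map x) ?index_mem // nth_index.
have {FP} [F FP] := choice FP.
(* [k] codes a piece [m], a position [j] in its list and a rational time [r]. Invalid codes and
   positions give the zero function, which changes nothing. *)
pose g k y := if unpickle k is Some (m, j, r) then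
   nth (fun=> 0) (F m) j (f (ratr r : R) y) else 0 : R.
have gmr m j (r : rat) y : g (pickle (m, j, r)) y = nth (fun=> 0) (F m) j (f (ratr r) y).
  by rewrite /g pickleK.
have [||phi cphi phiP] := @weighted_sum R M g.
- move=> k y; rewrite /g; case: unpickle => [[[m j] r]|]; last exact: cont_cst.
  have [/(_ j)[cv _ _] _] := FP m.
  apply: (cont_comp (f := f (ratr r))); last exact: cv.
  by apply: (cont_flow flow_f); [exact: cont_cst|exact: cont_id].
- move=> k y; rewrite /g; case: unpickle => [[[m j] r]|]; last by rewrite lexx ler01.
  by have [/(_ j)[_ + _] _] := FP m; apply.
exists phi; split=> // x Cx t t0; have [m Kx] := Kex x Cx.
have [gm /(_ x Kx)[j jP]] := FP m; have [cv _ mv] := gm j.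
have [r rP] := strictly_decreasing_at_rat flow_f cv mv jP t0.
apply: (phiP _ _ (pickle (m, j, r))); last by rewrite !gmr.
move=> k; rewrite /g; case: unpickle => [[[m' j'] r']|] //.
have [/(_ j')[_ _ mv'] _] := FP m'.
by rewrite !(flowD flow_f) addrC -(flowD flow_f) mv' // ltW.
Qed.

(** * Orbit equivalence of functions decreasing along a dilation flow *)

(** The part of the graph whose values lie off [V] is compact, so its projection is closed, and the
    complement of the projection is a neighbourhood of [x]. *)
Lemma graph_continuous (X Y : topologicalType) (G : X -> Y -> Prop) (h : X -> Y) :
  hausdorff_space X -> compact [set p : X * Y | G p.1 p.2] ->
  (forall x y y', G x y -> G x y' -> y = y') ->
  (forall x, (exists y, G x y) -> G x (h x)) ->
  {within [set x | exists y, G x y], continuous h}.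
Proof.
move=> hX cG fG Gh; apply/subspace_continuousP => x xG O.
rewrite nbhsE => -[V [oV Vx] VO].
pose K := [set p : X * Y | G p.1 p.2] `&` [set p | ~ V p.2].
have cK : compact K.
  apply: compact_closedI => //.
  apply: (@closed_comp _ _ snd (~` V)); last exact: open_closedC.
  by move=> p _; exact: cvg_snd.
have cK1 : closed (fst @` K).
  apply: compact_closed => //; apply: continuous_compact => //.
  by apply: continuous_subspaceT => p; exact: cvg_fst.
have : nbhs x (~` (fst @` K)).
  apply: open_nbhs_nbhs; split; first exact: closed_openC.
  move=> [[z y] [/= Gzy Oy] zx]; apply: Oy; move: Gzy; rewrite zx => Gxy.
  by rewrite (fG _ _ _ Gxy (Gh _ xG)).
apply: filterS => z zK zG; apply: VO; apply: contrapT => Ohz; apply: zK.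
by exists (z, h z) => //; split=> //=; exact: Gh.
Qed.

Lemma graph_homeomorphism (X : topologicalType) (G : X -> X -> Prop) (v : X) :
  hausdorff_space X -> compact [set p : X * X | G p.1 p.2] ->
  (forall x y y', G x y -> G x y' -> y = y') ->
  (forall x x' y, G x y -> G x' y -> x = x') ->
  G v v -> nbhs v [set x | exists y, G x y] -> nbhs v [set y | exists x, G x y] ->
  exists (N W : set X) (h : X -> X), [/\ nbhs v N, open W, homeomorphism_on N W h,
    h v = v & forall x, N x -> G x (h x)].
Proof.
move=> hX cG fG iG Gvv domv ranv.
pose h x := xget v [set y | G x y]; pose h' y := xget v [set x | G x y].
have Gh x : (exists y, G x y) -> G x (h x) by move=> Gx; exact: (xgetPex v Gx).
have Gh' y : (exists x, G x y) -> G (h' y) y by move=> Gy; exact: (xgetPex v Gy).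
pose D := [set x | exists y, G x y]; pose E := [set y | exists x, G x y].
have ch : {within D, continuous h} by exact: graph_continuous.
have ch' : {within E, continuous h'}.
  apply: (graph_continuous (G := fun y x => G x y)) => //; last first.
    by move=> y x x'; exact: iG.
  have -> : [set p : X * X | G p.2 p.1] = (fun p => (p.2, p.1)) @` [set p : X * X | G p.1 p.2].
    apply/seteqP; split=> [[y x] /= Gxy|_ [[x y] /= Gxy <-] //].
    by exists (x, y).
  apply: continuous_compact => //; apply: continuous_subspaceT => p.
  by apply: cont_pair; [exact: cvg_snd|exact: cvg_fst].
have hv : h v = v by apply: (fG v) => //; apply: Gh; exists v.
(* The range is cut down to its interior to make the target open. *)
exists (D `&` h @^-1` E°), E°, h; split=> //.
- have Dv : D v by exists v.
  have /subspace_continuousP/(_ v Dv) cv := ch.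
  have : h @ within D (nbhs v) --> h v := cv.
  rewrite hv => /(_ E° (nbhs_interior ranv)) hE.
  by move: domv hE; apply: filterS2 => x Dx hx; split=> //; exact: hx.
- exact: open_interior.
- exists h'; split.
  + split=> [x [Dx hx] //|y Ey].
    have GE : G (h' y) y by apply: Gh'; exact: interior_subset Ey.
    split; first by exists y.
    have hh : h (h' y) = y by apply: (fG (h' y) _ _ (Gh _ _) GE); exists y.
    by rewrite /preimage /= hh.
  + split=> [x|y]; rewrite inE.
      move=> [Dx _]; apply: (iG _ _ (h x)); last exact: Gh.
      by apply: Gh'; exists x; exact: Gh.
    move=> /interior_subset Ey; apply: (fG (h' y)); last exact: Gh'.
    by apply: Gh; exists y; exact: Gh'.
  + by apply: continuous_subspaceW ch => x [].
  + by apply: continuous_subspaceW ch'; exact: interior_subset.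
- by move=> x [Dx _]; exact: Gh.
Qed.

(** The linear flow with [s = 2^t]. A predicate in place of an index makes time reversal the passage
    to [predC P], so that facts on stable directions also yield those on unstable ones. *)
Definition dil (R : realType) n (P : pred 'I_n) (s : R) (u : 'rV[R]_n) : 'rV[R]_n :=
  \row_i (if P i then s * u 0 i else s^-1 * u 0 i).

Section Dilation.
Variables (R : realType) (n : nat).
Implicit Types (P : pred 'I_n) (s t : R) (u w v : 'rV[R]_n) (psi : 'rV[R]_n -> R).

Lemma dil1 P u : dil P 1 u = u.
Proof. by apply/rowP => i; rewrite mxE invr1 !mul1r; case: ifP. Qed.

Lemma dilM P s t u : dil P s (dil P t u) = dil P (s * t) u.
Proof. by apply/rowP => i; rewrite !mxE invfM; case: (P i); exact: mulrA. Qed.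

Lemma dil0 P s : dil P s 0 = 0.
Proof. by apply/rowP => i; rewrite !mxE !mulr0; case: ifP. Qed.

Lemma dil_eq0 P s u : s != 0 -> (dil P s u == 0) = (u == 0).
Proof.
move=> s0; apply/eqP/eqP => [E|->]; last exact: dil0.
by rewrite -(dil1 P u) -(mulVf s0) -dilM E dil0.
Qed.

Lemma dilC P s u : dil (predC P) s u = dil P s^-1 u.
Proof. by apply/rowP => i; rewrite !mxE invrK /=; case: (P i). Qed.

Lemma cont_dil P (T : topologicalType) (x : T) (a : T -> R) (g : T -> 'rV[R]_n) :
  a x != 0 -> continuous_at x a -> continuous_at x g ->
  continuous_at x (fun q => dil P (a q) (g q)).
Proof.
move=> ax ca cg; apply: cont_row => i; under eq_fun do rewrite mxE.
case: (P i).
  by apply: (@contM R _ x a (fun q => g q 0 i)) => //; exact: cont_coord.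
apply: (@contM R _ x (fun q => (a q)^-1) (fun q => g q 0 i)); last exact: cont_coord.
exact: contV.
Qed.

(** Each coordinate is monotone in [t] and the ball is a box, so an arc of orbit with both ends in
    it stays inside. *)
Lemma dil_convex P (v u : 'rV[R]_n) (e a b t : R) : 0 <= e -> 0 < a -> a <= t -> t <= b ->
  `|dil P a u - v| <= e -> `|dil P b u - v| <= e -> `|dil P t u - v| <= e.
Proof.
move=> e0 a0 at_ tb ua ub; apply: rV_norm_le => // i.
have := le_trans (rV_entry_le _ i) ua; have := le_trans (rV_entry_le _ i) ub.
have t0 : 0 < t by apply: lt_le_trans at_.
have b0 : 0 < b by apply: lt_le_trans tb.
have btw (x y z c : R) : x <= y -> y <= z -> `|z * c - v 0 i| <= e ->
    `|x * c - v 0 i| <= e -> `|y * c - v 0 i| <= e.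
  move=> xy yz; rewrite !ler_norml => /andP[? ?] /andP[? ?].
  case: (leP 0 c) => c0.
    have := ler_wpM2r c0 xy; have := ler_wpM2r c0 yz => ? ?.
    by apply/andP; split; lra.
  have := ler_wnM2r (ltW c0) xy; have := ler_wnM2r (ltW c0) yz => ? ?.
  by apply/andP; split; lra.
rewrite !mxE; case: (P i); first exact: btw.
by move=> h1 h2; apply: btw h2 h1; rewrite lef_pV2 ?posrE.
Qed.

Definition decreasing_on P (B : set 'rV[R]_n) psi :=
  forall u s, 1 < s -> u != 0 -> B u -> B (dil P s u) -> psi (dil P s u) < psi u.

(* Parametrized by the inverse [s] of the dilation factor, the relation is
   closed; [s = 0] adds the pairs linking the stable to the unstable space. *)
Definition slide P (s : R) u w :=
  forall i, if P i then u 0 i = s * w 0 i else w 0 i = s * u 0 i.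

Lemma slide_dil P s u w : 0 < s -> slide P s u w -> w = dil P s^-1 u.
Proof.
move=> s0 S; apply/rowP => i; rewrite mxE; have := S i.
by case: (P i) => ->; rewrite ?invrK // mulKf // gt_eqF.
Qed.

Lemma dil_slide P s u : 0 < s -> slide P s^-1 u (dil P s u).
Proof.
by move=> s0 i; rewrite !mxE; case: (P i) => //; rewrite mulKf // gt_eqF.
Qed.

(** Allowing both directions of sliding keeps the parameter in the compact interval from 0 to 1. *)
Definition orbit_match P (B : set 'rV[R]_n) (psi1 psi2 : 'rV[R]_n -> R) u w :=
  [/\ B u, B w, psi1 u = psi2 w &
    exists2 s : R, 0 <= s <= 1 & slide P s u w \/ slide P s w u].

(** Says that the limit pairs with [s = 0], a stable point and an unstable one, match only at the
    origin. *)
Definition separated P (B : set 'rV[R]_n) (psi1 psi2 : 'rV[R]_n -> R) :=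
  forall u w, B u -> B w -> (forall i, P i -> u 0 i = 0) ->
    (forall i, ~~ P i -> w 0 i = 0) -> psi1 u = psi2 w -> u = 0 /\ w = 0.

Section Matching.
Variables (P : pred 'I_n) (B : set 'rV[R]_n) (psi1 psi2 : 'rV[R]_n -> R).
Hypothesis sep12 : separated P B psi1 psi2.
Hypothesis sep21 : separated P B psi2 psi1.

Lemma orbit_match_dil u w : orbit_match P B psi1 psi2 u w ->
  exists2 s, 0 < s & w = dil P s u.
Proof.
move=> [Bu Bw E [s /andP[s0 s1] S]]; move: s0; rewrite le_eqVlt => /orP[/eqP s0|s0]; last first.
  case: S => /(slide_dil s0) ->; first by exists s^-1 => //; rewrite invr_gt0.
  by exists s => //; rewrite dilM mulfV ?dil1 // gt_eqF.
have [-> ->] : u = 0 /\ w = 0; last by exists 1; rewrite ?ltr01 ?dil1.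
case: S => S.
  apply: sep12 => // i Pi; have := S i; rewrite -s0 !mul0r ?Pi //.
  by rewrite (negbTE Pi).
have [||-> ->] // := sep21 Bw Bu _ _ (esym E); move=> i Pi; have := S i; rewrite -s0 !mul0r ?Pi //.
by rewrite (negbTE Pi).
Qed.

(** Two partners of [u] lie on one orbit, along which [psi2] is strictly decreasing. *)
Lemma orbit_match_fun u w w' : decreasing_on P B psi2 ->
  orbit_match P B psi1 psi2 u w -> orbit_match P B psi1 psi2 u w' -> w = w'.
Proof.
move=> dec m m'; have [s s0 ws] := orbit_match_dil m; have [s' s'0 ws'] := orbit_match_dil m'.
case: m => _ Bw E _; case: m' => _ Bw' E' _.
wlog ss : s s' w w' s0 s'0 ws ws' Bw Bw' E E' / s < s' => [H|].
  case: (ltgtP s s') => ss; [exact: (H s s')|by apply/esym; exact: (H s' s)|].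
  by rewrite ws ws' ss.
have w'w : w' = dil P (s' / s) w by rewrite ws dilM divfK ?gt_eqF.
have [w0|w0] := eqVneq w 0; first by rewrite w'w w0 dil0.
have := dec w (s' / s); rewrite -w'w -E -E' ltxx => H; exfalso.
have : false by apply: H => //; rewrite ltr_pdivlMr // mul1r.
by [].
Qed.

End Matching.

Lemma orbit_match_sym P B psi1 psi2 u w :
  orbit_match P B psi1 psi2 u w <-> orbit_match P B psi2 psi1 w u.
Proof.
by split=> -[Bu Bw E [s s01 [S|S]]]; split=> //; exists s => //; [right|left|right|left].
Qed.

(** With [s] as a third coordinate the conditions are closed; the relation is the projection of the
    compact set obtained. *)
Lemma orbit_match_compact P B psi1 psi2 : compact B ->
  (forall u, continuous_at u psi1) -> (forall u, continuous_at u psi2) ->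
  compact [set p | orbit_match P B psi1 psi2 p.1 p.2].
Proof.
move=> cB c1 c2.
pose Q : set ('rV[R]_n * 'rV[R]_n * R) :=
  (B `*` B) `*` `[0, 1]%classic.
have cQ : compact Q.
  by apply: compact_setX; [exact: compact_setX|exact: segment_compact].
have closed_eq0 (g : 'rV[R]_n * 'rV[R]_n * R -> R) : (forall q, continuous_at q g) ->
    closed [set q | g q = 0].
  by move=> cg; apply: (@closed_comp _ _ g [set t | t = 0]); [move=> q _; exact: cg|exact: closed_eq].
have c11 (q : 'rV[R]_n * 'rV[R]_n * R) : continuous_at q (fun q => q.1.1).
  by apply: (cont_comp (f := fst) (g := fst)); exact: cvg_fst.
have c12 (q : 'rV[R]_n * 'rV[R]_n * R) : continuous_at q (fun q => q.1.2).
  by apply: (cont_comp (f := fst) (g := snd)); [exact: cvg_fst|exact: cvg_snd].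
have cs (q : 'rV[R]_n * 'rV[R]_n * R) : continuous_at q (fun q => q.2).
  exact: cvg_snd.
pose Z1 := [set q : 'rV[R]_n * 'rV[R]_n * R | psi1 q.1.1 - psi2 q.1.2 = 0].
pose S1 := \bigcap_(i in [set: 'I_n]) [set q : 'rV[R]_n * 'rV[R]_n * R |
  (if P i then q.1.1 0 i - q.2 * q.1.2 0 i else q.1.2 0 i - q.2 * q.1.1 0 i) = 0].
pose S2 := \bigcap_(i in [set: 'I_n]) [set q : 'rV[R]_n * 'rV[R]_n * R |
  (if P i then q.1.2 0 i - q.2 * q.1.1 0 i else q.1.1 0 i - q.2 * q.1.2 0 i) = 0].
have cZ : closed (Z1 `&` (S1 `|` S2)).
  apply: closedI.
    apply: closed_eq0 => q; apply: (contB R).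
      exact: (cont_comp (f := fun q : 'rV[R]_n * 'rV[R]_n * R => q.1.1)).
    exact: (cont_comp (f := fun q : 'rV[R]_n * 'rV[R]_n * R => q.1.2)).
  have aux (g h : 'rV[R]_n * 'rV[R]_n * R -> 'rV[R]_n) i q : continuous_at q g ->
      continuous_at q h -> continuous_at q (fun q => g q 0 i - q.2 * h q 0 i).
    move=> cg ch; apply: (contB R); first exact: cont_coord.
    by apply: (@contM R _ q snd (fun q => h q 0 i)); [exact: cs|exact: cont_coord].
  by apply: closedU; apply: closed_bigI => i _; apply: closed_eq0 => q;
    case: (P i); apply: aux.
have -> : [set p | orbit_match P B psi1 psi2 p.1 p.2] = fst @` (Q `&` (Z1 `&` (S1 `|` S2))).
  have sub0 (x y : R) : x - y = 0 <-> x = y.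
    by split=> [/eqP|->]; rewrite ?subrr // subr_eq0 => /eqP.
  apply/seteqP; split=> [[u w] /= [Bu Bw E [s s01 S]]|_ [[[u w] s] [[[/= Bu Bw] s01] [E S]] <-]].
    exists ((u, w), s) => //; split; first by split=> //=; rewrite in_itv.
    split; first exact/sub0.
    by case: S => S; [left|right] => i _ /=; have := S i; case: (P i) => /sub0.
  split=> //=; first exact/sub0.
  exists s; first by move: s01; rewrite /= in_itv.
  by case: S => S; [left|right] => i; have := S i I; rewrite /=; case: (P i) => /sub0.
apply: continuous_compact; last exact: compact_closedI.
by apply: continuous_subspaceT => p; exact: cvg_fst.
Qed.

(** One of the two inequalities for the intermediate value theorem along the orbit of [u]; the other
    one is the same condition for the reversed flow and the negated functions. *)
Definition overtakes P (B : set 'rV[R]_n) (psi1 psi2 : 'rV[R]_n -> R) u :=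
  exists s, [/\ 1 <= s, B (dil P s u) & psi2 (dil P s u) <= psi1 u].

Lemma orbit_match_ex P v e psi1 psi2 u : 0 < e -> (forall u, continuous_at u psi2) ->
  let B := [set u | `|u - v| <= e] in
  B u -> overtakes P B psi1 psi2 u ->
  overtakes (predC P) B (fun x => - psi1 x) (fun x => - psi2 x) u ->
  exists w, orbit_match P B psi1 psi2 u w.
Proof.
move=> e0 c2 B Bu [b [b1 Bb lb]] [a [a1 Ba]].
rewrite dilC in Ba *; rewrite lerN2 => la.
have a0 : 0 < a by apply: lt_le_trans a1.
have ai : 0 < a^-1 by rewrite invr_gt0.
have aib : a^-1 <= b by rewrite (le_trans _ b1) // invf_le1.
have cpsi : {within `[a^-1, b], continuous (fun s => psi2 (dil P s u))}.
  apply: continuous_in_subspaceT => s; rewrite inE /= in_itv /= => /andP[sa _].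
  apply: (cont_comp (f := fun s => dil P s u)); last exact: c2.
  apply: cont_dil; [|exact: cont_id|exact: cont_cst].
  by rewrite gt_eqF // (lt_le_trans ai).
have [|c] := @IVT R (fun s => psi2 (dil P s u)) _ _ (psi1 u) aib cpsi.
  by rewrite ge_min le_max lb la orbT.
rewrite in_itv /= => /andP[ac cb] E.
have c0 : 0 < c by rewrite (lt_le_trans ai).
exists (dil P c u); split=> //.
  by apply: (dil_convex (a := a^-1) (b := b)) => //; exact: ltW.
case: (leP 1 c) => c1.
  by exists c^-1; [rewrite invr_ge0 (ltW c0) invf_le1|left; exact: dil_slide].
exists c; first by rewrite !ltW.
by right => i; rewrite !mxE; case: (P i) => //; rewrite mulVKf // gt_eqF.
Qed.

(** Of the four [overtakes] conditions, the first and third give every point near [v] a partner, the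
    second and fourth make every point near [v] a partner. *)
Lemma orbit_equivalence P v e psi1 psi2 :
  0 < e -> (forall u, continuous_at u psi1) -> (forall u, continuous_at u psi2) ->
  let B := [set u | `|u - v| <= e] in
  decreasing_on P B psi1 -> decreasing_on P B psi2 ->
  separated P B psi1 psi2 -> separated P B psi2 psi1 -> psi1 v = psi2 v ->
  (\forall u \near v, overtakes P B psi1 psi2 u) ->
  (\forall u \near v, overtakes P B psi2 psi1 u) ->
  (\forall u \near v, overtakes (predC P) B (fun x => - psi1 x) (fun x => - psi2 x) u) ->
  (\forall u \near v, overtakes (predC P) B (fun x => - psi2 x) (fun x => - psi1 x) u) ->
  exists (N W : set 'rV[R]_n) (h : 'rV[R]_n -> 'rV[R]_n),
  [/\ nbhs v N, open W, homeomorphism_on N W h, h v = v & forall u, N u -> psi1 u = psi2 (h u)].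
Proof.
move=> e0 c1 c2 B d1 d2 s12 s21 E o1 o2 o3 o4.
have Bv : nbhs v B.
  have := nbhsx_ballx v e e0; apply: filterS => u; rewrite -ball_normE /= distrC.
  exact: ltW.
have cB : compact B.
  have -> : B = (fun x => x + v) @` [set x | `|x| <= e].
    apply/seteqP; split=> [x Bx|_ [x xe <-]]; last by rewrite /B /= addrK.
    by exists (x - v) => //; rewrite subrK.
  apply: continuous_compact; last exact: compact_closed_cball.
  by apply: continuous_subspaceT => x; apply: cont_add; [exact: cont_id|exact: cont_cst].
have [|||||||N [W [h [Nv oW hh hv hG]]]] :=
    @graph_homeomorphism _ (orbit_match P B psi1 psi2) v.
- exact: norm_hausdorff.
- exact: orbit_match_compact.
- by move=> u w w'; apply: orbit_match_fun.
- move=> u w w' /orbit_match_sym m /orbit_match_sym m'.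
  exact: (orbit_match_fun s21 s12 d1 m m').
- split=> //; [by rewrite /B /= subrr normr0 ltW|by rewrite /B /= subrr normr0 ltW|].
  exists 1; first by rewrite ler01 lexx.
  by left => i; rewrite mul1r; case: (P i).
- move: Bv o1 o3; apply: filterS3 => u; exact: orbit_match_ex.
- move: Bv o2 o4; apply: filterS3 => u Bu h1 h2.
  have [w /orbit_match_sym m] := orbit_match_ex e0 c1 Bu h1 h2.
  by exists w.
by exists N, W, h; split=> // u Nu; have [_ _ -> _] := hG _ Nu.
Qed.

End Dilation.

(** * Normal forms at the saddle and at the other points of a chart *)

Section NormalForms.
Variables (R : realType) (n : nat).
Implicit Types (P : pred 'I_n) (s t e r q : R) (u w v : 'rV[R]_n) (psi : 'rV[R]_n -> R).

Lemma near_lt (T : topologicalType) (g h : T -> R) (x : T) :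
  continuous_at x g -> continuous_at x h -> g x < h x -> \forall y \near x, g y < h y.
Proof.
move=> cg ch gh; have c : continuous_at x (fun y => h y - g y) by exact: contB ch cg.
have N0 : nbhs (h x - g x) [set z : R | 0 < z].
  by apply: open_nbhs_nbhs; split; [exact: open_gt|rewrite /= subr_gt0].
have N : nbhs x (fun y => 0 < h y - g y) := c _ N0.
by apply: filterS N => y; rewrite subr_gt0.
Qed.

(** A chart controls the flow for short times only. A large factor is split into [N] equal ones, and
    the intermediate points stay in the box by [dil_convex]. *)
Lemma decreasing_on_box P v e r q psi : 0 <= e -> 1 < q ->
  (forall u, `|u - v| <= e -> `|u| <= r) ->
  (forall u s, `|u| <= r -> u != 0 -> 1 < s -> s <= q -> psi (dil P s u) < psi u) ->
  decreasing_on P [set u | `|u - v| <= e] psi.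
Proof.
move=> e0 q1 Br small u s s1 u0 Bu Bs.
have lq : 0 < ln q by rewrite ln_gt0.
have ls : 0 < ln s by rewrite ln_gt0.
pose N := (Num.truncn (ln s / ln q)).+1.
have N0 : 0 < N%:R :> R by rewrite ltr0n.
pose z := expR (ln s / N%:R).
have z1 : 1 < z by rewrite /z expR_gt1 divr_gt0.
have zN : z ^+ N = s.
  by rewrite /z -expRM_natl mulrC divfK ?gt_eqF // lnK // posrE (lt_trans ltr01).
have zq : z <= q.
  rewrite -[q]lnK ?posrE ?(lt_trans ltr01) // /z ler_expR.
  by rewrite ler_pdivrMr // mulrC -ler_pdivrMr // ltW //; exact: truncnS_gt.
have Bk k : (k <= N)%N -> `|dil P (z ^+ k) u - v| <= e.
  move=> kN; apply: (dil_convex (a := 1) (b := s)) => //.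
  - by rewrite exprn_ege1 // ltW.
  - by rewrite -zN ler_weXn2l // ltW.
  - by rewrite dil1.
suff : forall k, (k < N)%N -> psi (dil P (z ^+ k.+1) u) < psi u.
  by move=> /(_ N.-1 (leqnn _)); rewrite prednK // zN.
elim=> [|k IH] kN; first by rewrite expr1; apply: small => //; exact: Br.
apply: lt_trans (IH (ltnW kN)); rewrite exprS -dilM; apply: small => //.
  by apply: Br; apply: Bk; exact: ltnW.
by rewrite dil_eq0 // gt_eqF // exprn_gt0 // (lt_trans ltr01).
Qed.

Lemma decreasing_onC P (B : set 'rV[R]_n) psi :
  decreasing_on P B psi -> decreasing_on (predC P) B (fun u => - psi u).
Proof.
move=> dec u s s1 u0 Bu; rewrite dilC ltrN2 => Bw.
have s0 : 0 < s by rewrite (lt_trans ltr01).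
have uE : u = dil P s (dil P s^-1 u) by rewrite dilM divff ?dil1 // gt_eqF.
rewrite [X in psi X < _]uE; apply: dec => //; last by rewrite -uE.
by rewrite dil_eq0 // invr_eq0 gt_eqF.
Qed.

Lemma norm_dil_stable P s u : 1 <= s -> (forall i, P i -> u 0 i = 0) ->
  `|dil P s u| <= `|u| / s.
Proof.
move=> s1 uP; have s0 : 0 < s by rewrite (lt_le_trans ltr01).
apply: rV_norm_le => [|i]; first by rewrite divr_ge0 // ltW.
rewrite mxE; case: ifP => [/uP ->|_]; first by rewrite mulr0 normr0 divr_ge0 // ltW.
have si : 0 <= s^-1 by rewrite invr_ge0 ltW.
by rewrite normrM mulrC (ger0_norm si) ler_wpM2r // rV_entry_le.
Qed.

Lemma stable_escape P s0 d u : 0 < d -> (forall i, P i -> u 0 i = 0) ->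
  exists s, [/\ 1 <= s, s0 < s & `|dil P s u| < d].
Proof.
move=> d0 uP; pose s := 1 + `|s0| + `|u| / d.
have ud : 0 <= `|u| / d by rewrite divr_ge0 // ltW.
have := ler_norm s0; have := normr_ge0 s0 => a0 a1.
have s1 : 1 <= s by rewrite /s; lra.
exists s; split=> //; first by rewrite /s; lra.
rewrite (le_lt_trans (norm_dil_stable s1 uP)) // ltr_pdivrMr ?(lt_le_trans ltr01) //.
rewrite mulrC -ltr_pdivrMr // /s; lra.
Qed.

(** The orbit of [u] tends to 0 while [psi] decreases. Passing to [dil P 2 u] first makes the
    inequality strict in the limit. *)
Lemma stable_gt P e psi u : let B := [set u | `|u - 0| <= e] in
  continuous_at (0 : 'rV[R]_n) psi -> decreasing_on P B psi -> B u ->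
  (forall i, P i -> u 0 i = 0) -> u != 0 -> psi 0 < psi u.
Proof.
move=> B c0 dec Bu uP u0.
have Bs s : 1 <= s -> B (dil P s u).
  move=> s1; rewrite /B /= subr0 (le_trans (norm_dil_stable s1 uP)) //.
  rewrite ler_pdivrMr ?(lt_le_trans ltr01) //; move: Bu; rewrite /B /= subr0 => ue.
  by rewrite (le_trans ue) // ler_peMr // (le_trans _ ue).
have B2 : B (dil P 2 u) by apply: Bs; lra.
have lt2 : psi (dil P 2 u) < psi u by apply: dec => //; lra.
apply: le_lt_trans lt2; rewrite leNgt; apply/negP => lt0.
have := near_lt (@cont_cst _ (0 : 'rV[R]_n) _ (psi (dil P 2 u))) c0 lt0.
move=> /nbhs_ballP[d /= d0 dP].
have [s [s1 s2 sd]] := stable_escape 2 d0 uP.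
have : psi (dil P 2 u) < psi (dil P s u).
  by apply: dP; rewrite -ball_normE /= sub0r normrN.
rewrite ltNge => /negP; apply; apply/ltW.
have -> : dil P s u = dil P (s / 2) (dil P 2 u) by rewrite dilM divfK.
apply: dec => //; first by rewrite ltr_pdivlMr // mul1r.
  by rewrite dil_eq0.
by rewrite dilM divfK //; exact: Bs.
Qed.

Lemma separated_saddle P e psi1 psi2 : let B := [set u | `|u - 0| <= e] in
  continuous_at (0 : 'rV[R]_n) psi1 -> continuous_at (0 : 'rV[R]_n) psi2 ->
  decreasing_on P B psi1 -> decreasing_on P B psi2 -> psi1 0 = psi2 0 ->
  separated P B psi1 psi2.
Proof.
move=> B c1 c2 d1 d2 E u w Bu Bw uP wP uw.
have h1 : u != 0 -> psi1 0 < psi1 u by move=> u0; exact: stable_gt d1 Bu uP u0.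
have h2 : w != 0 -> psi2 w < psi2 0.
  move=> w0; rewrite -ltrN2.
  exact: (stable_gt (contN R c2) (decreasing_onC d2) Bw wP w0).
have [u0|u0] := eqVneq u 0; have [w0|w0] := eqVneq w 0 => //; exfalso.
- by have := h2 w0; rewrite -uw u0 E ltxx.
- by have := h1 u0; rewrite uw w0 E ltxx.
- by have := h1 u0; rewrite uw E => h; have := lt_trans h (h2 w0); rewrite ltxx.
Qed.

(** A stable point flows close to 0, where [psi2] is below [psi1 u]. Any other point is dilated
    until its unstable part has norm [e]; its stable part is then still small, and [psi2] is below
    [psi2 0] by a definite amount. *)
Lemma overtakes_saddle P e psi1 psi2 : let B := [set u | `|u - 0| <= e] in
  0 < e -> (forall u, continuous_at u psi1) -> (forall u, continuous_at u psi2) ->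
  decreasing_on P B psi1 -> decreasing_on P B psi2 -> psi1 0 = psi2 0 ->
  \forall u \near (0 : 'rV[R]_n), overtakes P B psi1 psi2 u.
Proof.
move=> B e0 c1 c2 d1 d2 E.
pose pr u : 'rV[R]_n := \row_i (if P i then u 0 i else 0).
have cpr u : continuous_at u pr.
  apply: cont_row => i; under eq_fun do rewrite mxE.
  by case: (P i); [apply: cont_coord; exact: cont_id|exact: cont_cst].
(* The sphere of radius [e] in the unstable space, near which orbits leave the box; it is empty if
   there is no unstable direction. *)
pose C := [set u | `|u| <= e] `&` [set u | e <= `|u|] `&` [set u | `|u - pr u| <= 0].
have cC : compact C.
  apply: compact_closedI; first apply: compact_closedI; first exact: compact_closed_cball.
    apply: (@closed_comp _ _ (fun y : 'rV[R]_n => `|y|) [set t | e <= t]); last exact: closed_ge.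
    by move=> y _; apply: cont_norm; exact: cont_id.
  apply: (@closed_comp _ _ (fun y : 'rV[R]_n => `|y - pr y|) [set t | t <= 0]); last exact: closed_le.
  by move=> y _; apply: cont_norm; apply: cont_sub; [exact: cont_id|exact: cpr].
have C_lt u : C u -> psi2 u < psi2 0.
  move=> [[ue eu]]; rewrite /= normr_le0 subr_eq0 => /eqP upr.
  rewrite -ltrN2; apply: (stable_gt (contN R (c2 0)) (decreasing_onC d2)).
  - by rewrite /= subr0.
  - by move=> i; rewrite upr mxE /= => /negbTE ->.
  - by rewrite -normr_gt0 (lt_le_trans e0).
(* One [c] pays for replacing the exit point by its projection, the other for the difference between
   [psi1 u] and [psi1 0]. *)
have [c c0 Cc] : exists2 c, 0 < c & forall u, C u -> psi2 u <= psi2 0 - 2 * c.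
  have [C0|/set0P C0] := eqVneq C set0; first by exists 1 => // u; rewrite C0.
  have [|m mC mP] := compact_EVT_max C0 cC (f := psi2).
    by apply: continuous_in_subspaceT => u _; exact: c2.
  exists ((psi2 0 - psi2 m) / 2); first by rewrite divr_gt0 // subr_gt0 C_lt // -inE.
  by move=> u Cu; have := mP u; rewrite inE => /(_ Cu); lra.
have [|d d0 dP] := compact_unif_cont (f := psi2) (@compact_closed_cball R n e) _ c0.
  by move=> u _; exact: c2.
pose d' := Num.min (e / 2) (d / 2).
have d'0 : 0 < d' by rewrite lt_min !divr_gt0.
have d'e : d' <= e / 2 by rewrite ge_min lexx.
have d'd : d' <= d / 2 by rewrite ge_min lexx orbT.
have := nbhsx_ballx (0 : 'rV[R]_n) d' d'0.
have h1 : psi1 0 - c < psi1 0 by lra.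
have := near_lt (@cont_cst _ (0 : 'rV[R]_n) _ (psi1 0 - c)) (c1 0) h1.
apply: filterS2 => u u1; rewrite -ball_normE /= sub0r normrN => ud.
have Bu : B u by rewrite /B /= subr0; lra.
have [pu0|pu0] := eqVneq (pr u) 0.
  have uP i : P i -> u 0 i = 0.
    by move=> Pi; have /rowP/(_ i) := pu0; rewrite !mxE Pi.
  have [->|u0] := eqVneq u 0.
    by exists 1; split=> //; rewrite dil1 ?E // /B /= subrr normr0 ltW.
  have lt0 : psi2 0 < psi1 u by rewrite -E; exact: stable_gt d1 Bu uP u0.
  have := near_lt (c2 0) (@cont_cst _ (0 : 'rV[R]_n) _ (psi1 u)) lt0.
  move=> /nbhs_ballP[a /= a0 aP].
  have ae : 0 < Num.min a e by rewrite lt_min a0.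
  have [s [s1 _]] := stable_escape 1 ae uP; rewrite lt_min => /andP[sa se].
  exists s; split=> //; first by rewrite /B /= subr0 ltW.
  by apply/ltW/aP; rewrite -ball_normE /= sub0r normrN.
have m0 : 0 < `|pr u| by rewrite normr_gt0.
have mu : `|pr u| <= `|u|.
  apply: rV_norm_le => // i; rewrite mxE; case: ifP => _; rewrite ?normr0 //.
  exact: rV_entry_le.
pose s := e / `|pr u|.
have s1 : 1 <= s by rewrite ler_pdivlMr // mul1r; lra.
have s0 : 0 < s by rewrite (lt_le_trans ltr01).
have prs : pr (dil P s u) = s *: pr u.
  by apply/rowP => i; rewrite !mxE; case: (P i); rewrite ?mulr0.
have nprs : `|pr (dil P s u)| = e by rewrite prs normrZ gtr0_norm // divfK // gt_eqF.
have offs : `|dil P s u - pr (dil P s u)| <= `|u|.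
  apply: rV_norm_le => // i; rewrite !mxE; case: (P i); first by rewrite subrr normr0.
  rewrite subr0 normrM (le_trans _ (rV_entry_le u i)) // ler_piMl //.
  by rewrite ger0_norm ?invr_ge0 ?(ltW s0) // invf_le1.
have Bs : `|dil P s u| <= e.
  apply: rV_norm_le => [|i]; first exact: ltW.
  rewrite mxE; case Pi: (P i).
    by have := rV_entry_le (pr (dil P s u)) i; rewrite nprs !mxE Pi.
  have := rV_entry_le (dil P s u - pr (dil P s u)) i.
  rewrite !mxE Pi subr0 => h; rewrite (le_trans h) // (le_trans offs) //; lra.
exists s; split=> //; first by rewrite /B /= subr0.
have Cpr : C (pr (dil P s u)).
  split; first by split; rewrite /= nprs.
  have prK : pr (pr (dil P s u)) = pr (dil P s u) by apply/rowP => i; rewrite !mxE; case: (P i).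
  by rewrite /= prK subrr normr0.
have := Cc _ Cpr.
have : ball (psi2 (dil P s u)) c (psi2 (pr (dil P s u))).
  by apply: dP => //; rewrite -ball_normE /= (le_lt_trans offs) //; lra.
by rewrite -ball_normE /= ltr_norml => /andP[? ?] ?; lra.
Qed.

(** Away from the origin one factor slightly above 1 gives strict inequality at [v], which persists
    nearby. *)
Lemma overtakes_regular P v e psi1 psi2 : let B := [set u | `|u - v| <= e] in
  0 < e -> v != 0 -> continuous_at v psi1 -> (forall u, continuous_at u psi2) ->
  decreasing_on P B psi2 -> psi1 v = psi2 v ->
  \forall u \near v, overtakes P B psi1 psi2 u.
Proof.
move=> B e0 v0 c1 c2 dec E.
have [s s1 sB] : exists2 s, 1 < s & `|dil P s v - v| < e.
  have c : continuous_at (1 : R) (fun s => `|dil P s v - v|).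
    apply: cont_norm; apply: cont_sub; last exact: cont_cst.
    by apply: cont_dil; [rewrite oner_eq0|exact: cont_id|exact: cont_cst].
  have h : `|dil P 1 v - v| < e by rewrite dil1 subrr normr0.
  have := near_lt c (@cont_cst _ _ _ e) h.
  move=> /nbhs_ballP[d /= d0 dP]; exists (1 + d / 2); first by rewrite ltrDl divr_gt0.
  apply: dP; rewrite -ball_normE /= opprD addrA subrr sub0r normrN gtr0_norm ?divr_gt0 //.
  by rewrite ltr_pdivrMr // ltr_pMr // ltr1n.
have cs : continuous_at v (dil P s).
  by apply: cont_dil; [rewrite gt_eqF // (lt_trans ltr01)|exact: cont_cst|exact: cont_id].
have lt2 : psi2 (dil P s v) < psi1 v.
  rewrite E; apply: dec => //; last exact: ltW.
  by rewrite /B /= subrr normr0 ltW.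
have := near_lt (cont_comp cs (c2 _)) c1 lt2.
have cn : continuous_at v (fun u => `|dil P s u - v|).
  by apply: cont_norm; apply: cont_sub => //; exact: cont_cst.
have := near_lt cn (@cont_cst _ _ _ e) sB.
by apply: filterS2 => u h1 h2; exists s; split; [exact: ltW|exact: ltW|exact: ltW].
Qed.

Lemma cont_quad lam u : continuous_at u (@quad R n lam).
Proof.
apply: (contD R).
  apply: (contN R); apply: (cont_sum R) => i _; apply: (@contM R _ u (fun x => x 0 i) (fun x => x 0 i));
    by apply: cont_coord; exact: cont_id.
apply: (cont_sum R) => i _; apply: (@contM R _ u (fun x => x 0 i) (fun x => x 0 i));
  by apply: cont_coord; exact: cont_id.
Qed.

Lemma quad_decreasing lam (B : set 'rV[R]_n) : decreasing_on (fun i => (i < lam)%N) B (quad lam).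
Proof.
move=> u s s1 u0 _ _; have s0 : 0 < s by rewrite (lt_trans ltr01).
pose a (i : 'I_n) (w : 'rV[R]_n) := if (i < lam)%N then - w 0 i ^+ 2 else w 0 i ^+ 2.
have qE w : quad lam w = \sum_i a i w.
  rewrite /quad [RHS](bigID (fun i : 'I_n => (i < lam)%N)) /= -sumrN; congr (_ + _).
    by apply: eq_bigr => i ilam; rewrite /a ilam.
  by apply: eq_big => i; [rewrite -leqNgt|rewrite /a ltnNge => ->].
have [j uj] : exists j, u 0 j != 0.
  apply: contrapT => /forallNP N; move/negP: u0; apply; apply/eqP/rowP => j.
  by rewrite [RHS]mxE; apply/eqP; have /negP := N j; rewrite negbK.
have ss : 1 < s ^+ 2 by rewrite exprn_egt1 ?ltW.
have le i : a i (dil (fun i => (i < lam)%N) s u) <= a i u.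
  rewrite /a mxE /=; case: (_ < lam)%N; rewrite exprMn.
    by rewrite lerN2 ler_peMl ?sqr_ge0 // ltW.
  by rewrite ler_piMl ?sqr_ge0 // exprVn invf_le1 ?exprn_gt0 // ltW.
rewrite !qE (bigD1 j) //= [ltRHS](bigD1 j) //= ltr_leD //; last exact: ler_sum.
have uj2 : 0 < u 0 j ^+ 2 by rewrite lt_neqAle eq_sym sqrf_eq0 uj sqr_ge0.
rewrite /a mxE /=; case: (_ < lam)%N; rewrite exprMn.
  by rewrite ltrN2 ltr_pMl.
by rewrite gtr_pMl // exprVn invf_lt1 // exprn_gt0.
Qed.

Lemma saddle_normal_form lam psi r q : 0 < r -> 1 < q ->
  (forall u, continuous_at u psi) ->
  (forall u s, `|u| <= r -> u != 0 -> 1 < s -> s <= q ->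
     psi (dil (fun i => (i < lam)%N) s u) < psi u) ->
  exists (N W : set 'rV[R]_n) (h : 'rV[R]_n -> 'rV[R]_n),
  [/\ nbhs (0 : 'rV[R]_n) N, open W, homeomorphism_on N W h, h 0 = 0 &
      forall u, N u -> psi u = psi 0 + quad lam (h u)].
Proof.
move=> r0 q1 cpsi small; pose P : pred 'I_n := fun i => (i < lam)%N.
pose psi2 u := psi 0 + quad lam u.
pose B := [set u : 'rV[R]_n | `|u - 0| <= r].
have d1 : decreasing_on P B psi.
  by apply: decreasing_on_box (ltW r0) q1 _ small => u; rewrite subr0.
have d2 : decreasing_on P B psi2.
  by move=> u s s1 u0 Bu Bs; rewrite ltrD2l; apply: quad_decreasing s1 u0 Bu Bs.
have c2 u : continuous_at u psi2 by apply: (contD R); [exact: cont_cst|exact: cont_quad].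
have E : psi 0 = psi2 0.
  by rewrite /psi2 /quad !big1 ?subr0 ?oppr0 ?addr0 // => i _; rewrite mxE expr0n.
have NE : - psi 0 = - psi2 0 by rewrite E.
have cN1 u : continuous_at u (fun x => - psi x) by exact: contN.
have cN2 u : continuous_at u (fun x => - psi2 x) by exact: contN.
apply: (@orbit_equivalence R n P 0 r psi psi2) => //.
- exact: (separated_saddle (cpsi 0) (c2 0) d1 d2 E).
- exact: (separated_saddle (c2 0) (cpsi 0) d2 d1 (esym E)).
- exact: (overtakes_saddle r0 cpsi c2 d1 d2 E).
- exact: (overtakes_saddle r0 c2 cpsi d2 d1 (esym E)).
- exact: (overtakes_saddle r0 cN1 cN2 (decreasing_onC d1) (decreasing_onC d2) NE).
- exact: (overtakes_saddle r0 cN2 cN1 (decreasing_onC d2) (decreasing_onC d1) (esym NE)).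
Qed.

Lemma homeomorphism_on_comp (X Y Z : topologicalType) (N : set X) (W : set Y)
    (h : X -> Y) (a : Y -> Z) (b : Z -> Y) :
  homeomorphism_on N W h -> continuous a -> continuous b -> cancel a b -> cancel b a ->
  homeomorphism_on N (b @^-1` W) (a \o h).
Proof.
move=> [g [[hs gs] [hg gh] ch cg]] ca cb ab ba; exists (g \o b); split.
- split=> [x Nx|z Wz]; first by rewrite /preimage /= ab; exact: hs.
  exact: gs.
- split=> [x Nx|z]; first by rewrite /= ab hg.
  by rewrite inE => Wz /=; rewrite gh ?inE // ba.
- apply/subspace_continuousP => x Nx V /ca aV.
  by have /subspace_continuousP/(_ x Nx _ aV) := ch.
- apply/subspace_continuousP => z Wz.
  have /subspace_continuousP/(_ (b z) Wz) cgz := cg.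
  by move=> V /cgz gV; have := cb z _ gV.
Qed.

(** The comparison function is affine in a coordinate [j] with [v 0 j] nonzero. This coordinate
    keeps its sign on the box, so it is strictly monotone along orbits, and the box cannot meet both
    the stable and the unstable space. *)
Lemma regular_normal_form P psi r q v : `|v| < r -> v != 0 -> 1 < q ->
  (forall u, continuous_at u psi) ->
  (forall u s, `|u| <= r -> u != 0 -> 1 < s -> s <= q -> psi (dil P s u) < psi u) ->
  exists (N W : set 'rV[R]_n) (h : 'rV[R]_n -> 'rV[R]_n) (i : 'I_n),
  [/\ nbhs v N, open W, homeomorphism_on N W h, h v = 0 &
      i.+1 = n :> nat /\ forall u, N u -> psi u = psi v + h u 0 i].
Proof.
move=> vr v0 q1 cpsi small.
have [j vj] : exists j, v 0 j != 0.
  apply: contrapT => /forallNP N; move/negP: v0; apply; apply/eqP/rowP => j.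
  by rewrite [RHS]mxE; apply/eqP; have /negP := N j; rewrite negbK.
pose e := Num.min (r - `|v|) (`|v 0 j| / 2).
have vj0 : 0 < `|v 0 j| by rewrite normr_gt0.
have e0 : 0 < e by rewrite lt_min subr_gt0 vr divr_gt0.
have er : e <= r - `|v| by rewrite ge_min lexx.
have ej : e < `|v 0 j| by rewrite gt_min; apply/orP; right; lra.
pose B := [set u | `|u - v| <= e].
pose sg := Num.sg (v 0 j).
have sg2 : sg * sg = 1 by rewrite /sg -expr2 sqr_sg vj.
(* The modulus of coordinate [j] grows along the flow if [P j] and shrinks otherwise; the sign makes
   [psi2] decrease in both cases. *)
pose sgn := if P j then - sg else sg.
have sgn2 : sgn * sgn = 1 by rewrite /sgn; case: (P j); rewrite ?mulrNN.
pose psi2 u := psi v + sgn * (u 0 j - v 0 j).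
have Bj u : B u -> 0 < sg * u 0 j.
  move=> Bu; have := le_lt_trans (le_trans (rV_entry_le _ j) Bu) ej.
  rewrite !mxE /sg; case: (ltgtP (v 0 j) 0) (vj) => [v_lt|v_gt|->]; rewrite ?eqxx // => _.
    by rewrite (ltr0_sg v_lt) mulN1r (ltr0_norm v_lt) ltr_norml => /andP[_]; lra.
  by rewrite (gtr0_sg v_gt) mul1r (gtr0_norm v_gt) ltr_norml => /andP[]; lra.
have d1 : decreasing_on P B psi.
  apply: decreasing_on_box (ltW e0) q1 _ small => u uv.
  by rewrite -(subrK v u) (le_trans (ler_normD _ _)) //; lra.
have d2 : decreasing_on P B psi2.
  move=> u s s1 u0 Bu _; rewrite ltrD2l.
  have s0 : 0 < s by rewrite (lt_trans ltr01).
  have su := Bj u Bu; rewrite /sgn mxE; case: (P j).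
    have : sg * u 0 j < s * (sg * u 0 j) by rewrite ltr_pMl.
    by rewrite mulrCA; lra.
  have : s^-1 * (sg * u 0 j) < sg * u 0 j by rewrite gtr_pMl // invf_lt1.
  by rewrite mulrCA; lra.
have c2 u : continuous_at u psi2.
  apply: (contD R); first exact: cont_cst.
  apply: (contM R); first exact: cont_cst.
  by apply: (contB R); [apply: cont_coord; exact: cont_id|exact: cont_cst].
have E : psi v = psi2 v by rewrite /psi2 subrr mulr0 addr0.
have NE : - psi v = - psi2 v by rewrite E.
have cN1 u : continuous_at u (fun x => - psi x) by exact: contN.
have cN2 u : continuous_at u (fun x => - psi2 x) by exact: contN.
have sepB p1 p2 : separated P B p1 p2.
  move=> u w Bu Bw uP wP _; exfalso; case Pj: (P j).
    by have := Bj u Bu; rewrite uP // mulr0 ltxx.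
  by have := Bj w Bw; rewrite wP ?Pj // mulr0 ltxx.
have [N [W [h [Nv oW hh hv hN]]]] : exists (N W : set 'rV[R]_n) (h : 'rV[R]_n -> 'rV[R]_n),
  [/\ nbhs v N, open W, homeomorphism_on N W h, h v = v & forall u, N u -> psi u = psi2 (h u)].
  apply: (@orbit_equivalence R n P v e psi psi2) => //.
  - exact: (overtakes_regular e0 v0 (cpsi v) c2 d2 E).
  - exact: (overtakes_regular e0 v0 (c2 v) cpsi d1 (esym E)).
  - exact: (overtakes_regular e0 v0 (cN1 v) cN2 (decreasing_onC d2) NE).
  - exact: (overtakes_regular e0 v0 (cN2 v) cN1 (decreasing_onC d1) (esym NE)).
have n0 : (n.-1 < n)%N by rewrite ltn_predL (leq_ltn_trans _ (ltn_ord j)).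
pose i := Ordinal n0.
(* Moves [v] to the origin and coordinate [j], with its sign, to the last place; [b] is the
   inverse. *)
pose a (u : 'rV[R]_n) : 'rV[R]_n := \row_l (if l == i then sgn * (u 0 j - v 0 j)
   else u 0 (tperm i j l) - v 0 (tperm i j l)).
pose b (y : 'rV[R]_n) : 'rV[R]_n := \row_l (if l == j then sgn * y 0 i + v 0 j
   else y 0 (tperm i j l) + v 0 l).
have ab : cancel a b.
  move=> u; apply/rowP => l; rewrite !mxE eqxx; case: (eqVneq l j) => [->|lj].
    by rewrite mulrA sgn2 mul1r subrK.
  have -> : (tperm i j l == i) = false.
    by rewrite -[X in _ == X](tpermR i j) (inj_eq perm_inj) (negbTE lj).
  by rewrite tpermK subrK.
have ba : cancel b a.
  move=> y; apply/rowP => l; rewrite !mxE eqxx; case: (eqVneq l i) => [->|li].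
    by rewrite addrK mulrA sgn2 mul1r.
  have -> : (tperm i j l == j) = false.
    by rewrite -[X in _ == X](tpermL i j) (inj_eq perm_inj) (negbTE li).
  by rewrite tpermK addrK.
have ca : continuous a.
  move=> u; apply: cont_row => l; under eq_fun do rewrite mxE.
  case: (l == i); last first.
    by apply: (contB R); [apply: cont_coord; exact: cont_id|exact: cont_cst].
  apply: (@contM R _ u (fun=> sgn) (fun x => x 0 j - v 0 j)); first exact: cont_cst.
  by apply: (contB R); [apply: cont_coord; exact: cont_id|exact: cont_cst].
have cb : continuous b.
  move=> u; apply: cont_row => l; under eq_fun do rewrite mxE.
  case: (l == j); last first.
    apply: (@contD R _ u (fun x => x 0 (tperm i j l)) (fun=> v 0 l)); last exact: cont_cst.
    by apply: cont_coord; exact: cont_id.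
  apply: (@contD R _ u (fun x => sgn * x 0 i) (fun=> v 0 j)); last exact: cont_cst.
  apply: (@contM R _ u (fun=> sgn) (fun x => x 0 i)); first exact: cont_cst.
  by apply: cont_coord; exact: cont_id.
exists N, (b @^-1` W), (a \o h), i; split=> //.
- by apply: open_comp => // y _; exact: cb.
- exact: homeomorphism_on_comp.
- by apply/rowP => l; rewrite /= hv !mxE !subrr mulr0; case: ifP.
- split; first by rewrite /= prednK // (leq_ltn_trans _ (ltn_ord j)).
  by move=> u Nu; rewrite /= mxE eqxx hN.
Qed.

End NormalForms.

(** * Hyperbolic fixed points *)

Lemma homeomorphism_on_trans (X Y Z : topologicalType) (A : set X) (B N : set Y)
    (W : set Z) (h : X -> Y) (k : Y -> Z) :
  homeomorphism_on A B h -> homeomorphism_on N W k -> N `<=` B ->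
  homeomorphism_on [set x | A x /\ N (h x)] W (k \o h).
Proof.
move=> [g [[hs gs] [hg gh] ch cg]] [l [[ks ls] [kl lk] ck cl]] NB; exists (g \o l); split.
- split=> [x [Ax Nx]|z Wz]; first exact: ks.
  have Nl := ls _ Wz; split; first by apply: gs; exact: NB.
  by rewrite /= gh // inE; exact: NB.
- split=> [x|z]; rewrite inE => /=; first by move=> [Ax Nx]; rewrite kl ?inE // hg ?inE.
  by move=> Wz; rewrite gh ?lk ?inE //; apply: NB; exact: ls.
- apply/subspace_continuousP => x [Ax Nx] V hV.
  have /subspace_continuousP/(_ _ Nx V hV) := ck => kV.
  have kV' : nbhs (h x) (fun y => N y -> V (k y)) := kV.
  have /subspace_continuousP/(_ _ Ax _ kV') := ch => hkV.
  have hkV' : nbhs x (fun y => A y -> N (h y) -> V (k (h y))) := hkV.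
  suff : nbhs x (fun y => A y /\ N (h y) -> V (k (h y))) by [].
  by apply: filterS hkV' => y yV [Ay Ny]; exact: yV.
- apply/subspace_continuousP => z Wz V gV.
  have Bl : B (l z) by apply: NB; exact: ls.
  have /subspace_continuousP/(_ _ Bl V gV) := cg => gV'.
  have gV2 : nbhs (l z) (fun y => B y -> V (g y)) := gV'.
  have /subspace_continuousP/(_ _ Wz _ gV2) := cl => lV.
  have lV' : nbhs z (fun y => W y -> B (l y) -> V (g (l y))) := lV.
  suff : nbhs z (fun y => W y -> V (g (l y))) by [].
  by apply: filterS lV' => y yV Wy; apply: yV => //; apply: NB; exact: ls.
Qed.

Lemma within_interior_continuous (X Y : topologicalType) (A : set X) (h : X -> Y) (x : X) :
  {within A, continuous h} -> A° x -> continuous_at x h.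
Proof.
move=> /subspace_continuousP ch Ax V hV; have Ax' : A x by exact: interior_subset.
have hV' : nbhs x (fun y => A y -> V (h y)) := ch x Ax' V hV.
suff : nbhs x (fun y => V (h y)) by [].
have Ax2 : nbhs x A := Ax.
by apply: filterS (filterI hV' Ax2) => y [yV Ay]; exact: yV.
Qed.

(** * Independence of the chart *)

Section LocalCharts.
Variables (R : realType) (n : nat) (M : metricType R).

Lemma charts_local_homeo (p : M) (V0 V1 : set M) (k0 k1 : M -> 'rV[R]_n) :
  local_coordinates p V0 k0 -> local_coordinates p V1 k1 ->
  exists d k k', [/\ local_homeo d k k',
    forall x : 'rV[R]_n, `|x| < d -> exists y, [/\ V0 y, V1 y, k0 y = x & k1 y = k x] &
    forall x : 'rV[R]_n, `|x| < d -> exists y, [/\ V0 y, V1 y, k1 y = x & k0 y = k' x]].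
Proof.
move=> [V0p k0p [W0 [oW0 [l0 [[k0s l0s] [kl0 lk0] ck0 cl0]]]]].
move=> [V1p k1p [W1 [oW1 [l1 [[k1s l1s] [kl1 lk1] ck1 cl1]]]]].
have V0p' := nbhs_singleton V0p; have V1p' := nbhs_singleton V1p.
pose O := V0° `&` V1°.
have Op : nbhs p O by apply: filterI; exact: nbhs_interior.
have l00 : l0 0 = p by rewrite -k0p kl0 // inE.
have l10 : l1 0 = p by rewrite -k1p kl1 // inE.
have W00 : W0 0 by rewrite -k0p; exact: k0s.
have W10 : W1 0 by rewrite -k1p; exact: k1s.
have cl0W x : W0 x -> continuous_at x l0.
  by move=> Wx; apply: within_interior_continuous cl0 _; apply: open_nbhs_nbhs.
have cl1W x : W1 x -> continuous_at x l1.
  by move=> Wx; apply: within_interior_continuous cl1 _; apply: open_nbhs_nbhs.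
have N0 : nbhs (0 : 'rV[R]_n) (fun x => W0 x /\ O (l0 x)).
  apply: filterI; first by apply: open_nbhs_nbhs.
  by apply: (cl0W _ W00); rewrite /= l00.
have N1 : nbhs (0 : 'rV[R]_n) (fun x => W1 x /\ O (l1 x)).
  apply: filterI; first by apply: open_nbhs_nbhs.
  by apply: (cl1W _ W10); rewrite /= l10.
have /nbhs_ballP[d /= d0 dP] : nbhs (0 : 'rV[R]_n) (fun x =>
    (W0 x /\ O (l0 x)) /\ (W1 x /\ O (l1 x))) by exact: filterI N0 N1.
have {}dP x : `|x| < d -> [/\ W0 x, O (l0 x), W1 x & O (l1 x)].
  by move=> xd; have [] := dP x; [rewrite -ball_normE /= sub0r normrN|move=> [? ?] [? ?]].
exists d, (k1 \o l0), (k0 \o l1); split.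
- split=> //=; [by rewrite l00|by rewrite l10|].
  move=> x /dP [W0x [V0x V1x] W1x [V0x' V1x']]; split.
  + apply: cont_comp; first exact: cl0W.
    exact: within_interior_continuous ck1 _.
  + apply: cont_comp; first exact: cl1W.
    exact: within_interior_continuous ck0 _.
  + by rewrite /= kl1 ?lk0 // inE //; exact: interior_subset.
  + by rewrite /= kl0 ?lk1 // inE //; exact: interior_subset.
- move=> x /dP [W0x [V0x V1x] _ _]; exists (l0 x).
  by split=> //; [exact: interior_subset|exact: interior_subset|rewrite lk0 ?inE].
- move=> x /dP [_ _ W1x [V0x V1x]]; exists (l1 x).
  by split=> //; [exact: interior_subset|exact: interior_subset|rewrite lk1 ?inE].
Qed.

(** Non-degeneracy without the criticality clause, which is a consequence by
    [quadratic_not_regular]. *)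
Definition quadratic_at (phi : M -> R) (p : M) lam := exists (V : set M) (h : M -> 'rV[R]_n),
  local_coordinates p V h /\ forall y, V y -> phi y = phi p + quad lam (h y).

Lemma quadratic_not_regular phi p lam : (lam <= n)%N -> quadratic_at phi p lam ->
  ~ regular_point n phi p.
Proof.
move=> ln [V0 [k0 [lc0 q0]]] [V1 [k1 [i [lc1 _ q1]]]].
have [d [k [k' [lh h0 h1]]]] := charts_local_homeo lc0 lc1.
apply: (quad_not_linear (i := i) ln lh) => x xd.
  have [y [V0y V1y <- <-]] := h0 x xd.
  by apply: (addrI (phi p)); rewrite -q0 // -q1.
have [y [V0y V1y <- <-]] := h1 x xd.
by apply: (addrI (phi p)); rewrite -q0 // -q1.
Qed.

Lemma quadratic_index_le phi p lam nu : (lam <= n)%N ->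
  quadratic_at phi p lam -> quadratic_at phi p nu -> (lam <= nu)%N.
Proof.
move=> ln [V0 [k0 [lc0 q0]]] [V1 [k1 [lc1 q1]]].
have [d [k [k' [lh h0 h1]]]] := charts_local_homeo lc0 lc1.
apply: (quad_index_le ln lh) => x xd.
  have [y [V0y V1y <- <-]] := h0 x xd.
  by apply: (addrI (phi p)); rewrite -q0 // -q1.
have [y [V0y V1y <- <-]] := h1 x xd.
by apply: (addrI (phi p)); rewrite -q0 // -q1.
Qed.

Lemma nondegenerateE phi p nu : nondegenerate_of_index n phi p nu <->
  [/\ critical_set n phi p, (nu <= n)%N & quadratic_at phi p nu].
Proof.
by split=> -[cp nun [V [h [lc q]]]]; split=> //; exists V, h; split=> // y Vy; rewrite q // /quad addrA.
Qed.

End LocalCharts.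

Lemma dil_fixed (R : realType) n (P : pred 'I_n) (s : R) (u : 'rV[R]_n) :
  1 < s -> dil P s u = u -> u = 0.
Proof.
move=> s1 /rowP E; apply/rowP => i; have := E i; rewrite !mxE.
have s0 : s != 0 by rewrite gt_eqF // (lt_trans ltr01).
have aux (x : R) : s * x = x -> x = 0.
  move=> sx; have /eqP : (s - 1) * x = 0 by rewrite mulrBl mul1r sx subrr.
  by rewrite mulf_eq0 subr_eq0 gt_eqF //= => /eqP.
case: (P i) => [/aux //|h]; apply: aux.
by rewrite -[in LHS]h mulVKf.
Qed.

(** * The Lyapunov function in charts of hyperbolic points *)

Section HyperbolicCharts.
Variables (R : realType) (n : nat) (M : metricType R) (f : R -> M -> M) (phi : M -> R).
Hypothesis flow_f : topological_flow f.
Hypothesis cphi : continuous phi.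
Hypothesis fixC : forall p, chain_recurrent_set f p -> fixed_point f p.
Hypothesis decC : forall x, ~ chain_recurrent_set f x ->
  forall t, 0 < t -> phi (f t x) < phi x.

(** The conjugacy holds only where the flow stays in [U], which joint continuity at time 0 ensures
    near [p] for short times. *)
Lemma hyperbolic_chart p lam : hyperbolic_of_index n f p lam ->
  exists (U : set M) (h : M -> 'rV[R]_n) (g : 'rV[R]_n -> M) (r q : R),
  [/\ nbhs p U /\ h p = 0, homeomorphism_on U [set: 'rV[R]_n] h,
      continuous g /\ (forall y, U y -> g (h y) = y) /\ (forall u, h (g u) = u),
      0 < r /\ 1 < q &
      forall u s, `|u| <= r -> 1 < s -> s <= q ->
        exists2 t, 0 < t & g (dil (fun i => (i < lam)%N) s u) = f t (g u)].
Proof.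
move=> [fp _ [U [h [Up hh hp hf]]]]; have [g [[_ gs] [hg gh] _ cg]] := hh.
have {}cg : continuous g by move=> u; apply: within_interior_continuous cg _; rewrite interiorT.
have {}hg y : U y -> g (h y) = y by move=> Uy; rewrite hg ?inE.
have {}gh u : h (g u) = u by rewrite gh ?inE.
have g0 : g 0 = p by rewrite -hp hg //; exact: nbhs_singleton.
have cF : continuous_at ((0 : R), (0 : 'rV[R]_n)) (fun q => f q.1 (g q.2)).
  apply: (cont_flow flow_f); first exact: cvg_fst.
  by apply: (cont_comp (f := snd)); [exact: cvg_snd|exact: cg].
have : nbhs (f 0 (g 0)) U by rewrite (flow0 flow_f) g0.
move=> /cF /nbhs_ballP[e /= e0 eP].
have {}eP t u : `|t| < e -> `|u| < e -> U (f t (g u)).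
  move=> te ue; apply: (eP (t, u)); split=> /=.
    by rewrite -ball_normE /= sub0r normrN.
  by rewrite -ball_normE /= sub0r normrN.
have ee : e / 2 < e by rewrite ltr_pdivrMr // ltr_pMr // ltr1n.
have e2 : 0 < e / 2 by rewrite divr_gt0.
have l2 : 0 < ln (2 : R) by rewrite ln_gt0 // ltr1n.
(* A factor [s] takes the time [ln s / ln 2], and [s <= 2^(e / 2)] keeps this time at most
   [e / 2]. *)
exists U, h, g, (e / 2), (expR (e / 2 * ln 2)); split=> //.
  by split=> //; rewrite expR_gt1 mulr_gt0.
move=> u s ur s1 sq; have s0 : 0 < s by rewrite (lt_trans ltr01).
pose t := ln s / ln 2.
have t0 : 0 < t by rewrite divr_gt0 // ln_gt0.
have te : t < e.
  apply: le_lt_trans ee; rewrite ler_pdivrMr //.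
  by rewrite -ler_expR lnK // posrE.
exists t => //.
have Uf : U (f t (g u)) by apply: eP; [rewrite gtr0_norm|exact: le_lt_trans ur ee].
have := hf t (g u) (gs _ I) Uf; rewrite gh => E; rewrite -[RHS]hg // E; congr g.
have st : 2 `^ t = s by rewrite /powR gt_eqF // /t divfK ?gt_eqF // lnK.
by apply/rowP => i; rewrite !mxE powRN st.
Qed.

(** The shift by [T] lets the chart at a fixed point also serve at points whose orbit enters it;
    [T = 0] is the case of the fixed point. *)
Lemma chart_decreasing lam (T : R) h (g : 'rV[R]_n -> M) r q :
  (forall u : 'rV[R]_n, h (g u) = u) ->
  (forall u s, `|u| <= r -> 1 < s -> s <= q ->
        exists2 t, 0 < t & g (dil (fun i => (i < lam)%N) s u) = f t (g u)) ->
  forall u s, `|u| <= r -> u != 0 -> 1 < s -> s <= q ->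
  phi (f T (g (dil (fun i => (i < lam)%N) s u))) < phi (f T (g u)).
Proof.
move=> gh step u s ur u0 s1 sq; have [t t0 E] := step u s ur s1 sq.
rewrite E (flowD flow_f) addrC -(flowD flow_f); apply: decC => // /fixC fx.
have gu : g u = f T (g u) by rewrite -[LHS](flowK flow_f T) fx.
move/negP: u0; apply; apply/eqP; apply: (dil_fixed s1 (P := fun i => (i < lam)%N)).
by rewrite -[LHS]gh E gu fx -gu gh.
Qed.

Lemma hyperbolic_quadratic p lam : hyperbolic_of_index n f p lam ->
  quadratic_at n phi p lam.
Proof.
move=> hyp; have [U [h [g [r [q [[Up hp] hh [cg [hg gh]] [r0 q1] step]]]]]] := hyperbolic_chart hyp.
have g0 : g 0 = p by rewrite -hp hg //; exact: nbhs_singleton.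
have cpsi u : continuous_at u (phi \o g).
  by apply: cont_comp; [exact: cg|exact: cphi].
have [|N [W [k [N0 oW kk k0 kN]]]] := @saddle_normal_form R n lam (phi \o g) r q r0 q1 cpsi.
  move=> u s ur u0 s1 sq; have := chart_decreasing 0 gh step ur u0 s1 sq.
  by rewrite !(flow0 flow_f).
exists [set x | U x /\ N (h x)], (k \o h); split.
  split; last by exists W; split=> //; apply: homeomorphism_on_trans hh kk _.
    apply: filterI => //; have [_ [_ _ ch _]] := hh.
    apply: (within_interior_continuous ch); first exact: Up.
    by rewrite hp.
  by rewrite /= hp.
by move=> y [Uy Ny]; have := kN _ Ny; rewrite /= hg // g0.
Qed.

Lemma hyperbolic_regular x p lam : hyperbolic_of_index n f p lam ->
  ~ chain_recurrent_set f x -> (forall O, nbhs p O -> exists T, O (f (- T) x)) ->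
  regular_point n phi x.
Proof.
move=> hyp Cx back; have [fp _ _] := hyp.
have [U [h [g [r [q [[Up hp] hh [cg [hg gh]] [r0 q1] step]]]]]] := hyperbolic_chart hyp.
have g0 : g 0 = p by rewrite -hp hg //; exact: nbhs_singleton.
have [_ [_ _ ch _]] := hh.
have cat y t : continuous_at y (f t) by apply: (cont_flow flow_f); [exact: cont_cst|exact: cont_id].
have Op : nbhs p (fun y => U° y /\ `|h y| < r).
  apply: filterI; first exact: nbhs_interior.
  have cn : continuous_at p (fun y => `|h y|).
    by apply: cont_norm; apply: within_interior_continuous ch _; exact: Up.
  by apply: (near_lt cn (@cont_cst _ _ _ r)); rewrite hp normr0.
have [T [Uz hz]] := back _ Op.
set z := f (- T) x in Uz hz; pose v := h z.
have Uz' : U z by exact: interior_subset.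
have fz : f T z = x by rewrite (flowNK flow_f).
(* Otherwise [x] would be [p], which is chain recurrent by a single step of time 1. *)
have v0 : v != 0.
  apply/eqP => vz; have xp : x = p by rewrite -fz -(hg z) // -/v vz g0 fp.
  apply: Cx; rewrite xp => e e0; exists 1, 1%N, (fun=> p), (fun=> 1).
  by split=> //; [move=> i _; rewrite fp mdistxx|rewrite big_nat1].
have cpsi u : continuous_at u (fun u => phi (f T (g u))).
  apply: cont_comp; last exact: cphi.
  by apply: (cont_comp (f := g)); [exact: cg|exact: cat].
have [|N [W [k [i [Nv oW kk kv [iE kN]]]]]] :=
    @regular_normal_form R n (fun i => (i < lam)%N) _ r q v hz v0 q1 cpsi.
  exact: (chart_decreasing T gh step).
have hT : homeomorphism_on [set: M] [set: M] (f (- T)).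
  exists (f T); split.
  - by split.
  - by split=> y _; [exact: flowNK|exact: flowK].
  - by apply: continuous_subspaceT => y; exact: cat.
  - by apply: continuous_subspaceT => y; exact: cat.
have hhT := homeomorphism_on_trans hT hh (@subsetT _ _).
have hV := homeomorphism_on_trans hhT kk (@subsetT _ _).
exists [set y | ([set y | [set: M] y /\ U (f (- T) y)]) y /\ N ((h \o f (- T)) y)].
exists (k \o (h \o f (- T))), i; split=> //.
- split; [|by rewrite /= -/z -/v|by exists W].
  have cz : continuous_at z h by apply: within_interior_continuous ch Uz.
  apply: filterI; first apply: filterI; first exact: filterT.
    by apply: (cat x (- T)); exact: Uz.
  exact: (cont_comp (cat x (- T)) cz).
- move=> y [[_ Uy] Ny]; have := kN _ Ny; rewrite /= hg // (flowNK flow_f) => ->.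
  by rewrite -/z /v hg // fz.
Qed.

(** A cluster point of the backward orbit. Were it not chain recurrent, the orbit would return to a
    neighbourhood where [phi] exceeds [m] but drops below [m] within time 1; two visits contradict
    monotonicity. *)
Lemma backward_limit x : compact [set: M] ->
  exists2 p, chain_recurrent_set f p & forall O, nbhs p O -> exists T, O (f (- T) x).
Proof.
move=> cM; pose a (k : nat) := f (- k%:R) x.
have mono y t : 0 <= t -> phi (f t y) <= phi y.
  rewrite le_eqVlt => /orP[/eqP <-|t0]; first by rewrite (flow0 flow_f).
  have [Cy|Cy] := pselect (chain_recurrent_set f y); first by rewrite (fixC Cy).
  by rewrite ltW // decC.
have [p [_ clp]] := cM (a @ \oo) _ filterT.
have freq O m : nbhs p O -> exists2 k, (m <= k)%N & O (a k).
  move=> Op; have am : (a @ \oo) [set y | exists2 k, (m <= k)%N & y = a k].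
    by exists m => // k /= mk; exists k.
  by have [_ [[k mk ->] Ok]] := clp _ _ am Op; exists k.
exists p; last by move=> O /(freq O 0%N)[k _ Ok]; exists k%:R.
apply: contrapT => Cp; have := decC Cp ltr01 => lt1.
pose m := (phi (f 1 p) + phi p) / 2.
have cf1 : continuous_at p (fun y => phi (f 1 y)).
  apply: cont_comp; last exact: cphi.
  by apply: (cont_flow flow_f); [exact: cont_cst|exact: cont_id].
have lo : phi (f 1 p) < m by rewrite /m; lra.
have hi : m < phi p by rewrite /m; lra.
have Op : nbhs p (fun y => phi (f 1 y) < m /\ m < phi y).
  apply: filterI; first exact: (near_lt cf1 (@cont_cst _ _ _ m) lo).
  exact: (near_lt (@cont_cst _ _ _ m) (@cphi p) hi).
(* As [l] exceeds [k], the point [a k] is [f 1 (a l)] or comes later on its orbit. *)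
have [k _ [_ mk]] := freq _ 0%N Op; have [l kl [lm _]] := freq _ k.+1 Op.
have : phi (a k) <= phi (f 1 (a l)).
  have -> : a k = f (l%:R - k%:R - 1) (f 1 (a l)).
    by rewrite /a !(flowD flow_f); congr f; ring.
  by apply: mono; rewrite -natrB 1?ltnW // subr_ge0 ler1n subn_gt0.
by rewrite leNgt (lt_trans lm mk).
Qed.

End HyperbolicCharts.

Theorem theorem1 (R : realType) (n : nat) (M : metricType R) (f : R -> M -> M)
    (closedM : closed_manifold n M) (flow_f : topological_flow f)
    (finite_CR : finite_set (chain_recurrent_set f))
    (hyperbolic_CR : forall p, chain_recurrent_set f p ->
       topologically_hyperbolic n f p) :
  exists phi : M -> R, morse_energy_function n f phi.
Proof.
have [cM _] := closedM.
have clC : closed (chain_recurrent_set f).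
  by apply: compact_closed; [exact: metric_hausdorff|exact: finite_compact].
have fixC p : chain_recurrent_set f p -> fixed_point f p.
  by move=> /hyperbolic_CR [lam []].
have [phi [cphi decC]] := lyapunov_exists cM flow_f clC.
have quadC := hyperbolic_quadratic (n := n) flow_f cphi fixC decC.
have critE : critical_set n phi = chain_recurrent_set f.
  apply/seteqP; split=> x; last first.
    move=> /hyperbolic_CR [lam hyp]; have [_ ln _] := hyp.
    exact: quadratic_not_regular ln (quadC _ _ hyp).
  move=> crit; apply: contrapT => Cx; apply: crit.
  have [p Cp back] := backward_limit flow_f cphi fixC decC x cM.
  have [lam hyp] := hyperbolic_CR p Cp.
  exact: (hyperbolic_regular flow_f cphi fixC decC hyp Cx back).
exists phi; split=> //.
- split=> // p cp; move: (cp); rewrite critE => /hyperbolic_CR [lam hyp].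
  exists lam; apply/nondegenerateE; have [_ ln _] := hyp.
  by split=> //; exact: quadC.
- move=> p _ lam nu hyp /nondegenerateE [_ nun qnu]; have [_ ln _] := hyp.
  have qlam := quadC _ _ hyp; apply/eqP; rewrite eqn_leq.
  by rewrite (quadratic_index_le nun qnu qlam) (quadratic_index_le ln qlam qnu).
Qed.
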